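(* Let $T>0$, $p>1$, $\beta>0$, and let $\varphi,\omega\in L^2(\mathbb{R})$. Let $w=R_\beta\varphi$ and $v=R_\beta\omega$ be the regularized solutions corresponding to the final values $\varphi$ and $\omega$, respectively. Then for every $t\in[0,T]$, $$\|w(\cdot,t)-v(\cdot,t)\|\le \beta^{\frac{t-T}{pT}}\,\|\varphi-\omega\|.$$
   Context: $\|\cdot\|$ denotes the norm of $L^2(\mathbb{R})$. The Fourier transform is $\hat\psi(\xi)=\frac{1}{\sqrt{2\pi}}\int_{-\infty}^{\infty}\psi(x)e^{-i\xi x}\,dx$ (extended to $L^2(\mathbb{R})$ as a unitary map). Fix $T>0$, $p>1$, $\beta>0$. For $\psi\in L^2(\mathbb{R})$, the regularized solution $R_\beta\psi$ is the function $(x,t)\mapsto (R_\beta\psi)(x,t)$, $t\in[0,T]$, whose Fourier transform in $x$ is $$\widehat{(R_\beta\psi)}(\xi,t)=\frac{e^{-t\xi^2}}{\beta e^{(p-1)T\xi^2}+e^{-T\xi^2}}\,\hat\psi(\xi)=\frac{e^{(T-t)\xi^2}}{1+\beta e^{pT\xi^2}}\,\hat\psi(\xi).$$ *)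

(* Defs.v *)
From mathcomp Require Import all_boot all_order all_algebra.
From mathcomp Require Import all_classical all_reals all_analysis.
Set Implicit Arguments. Unset Strict Implicit. Unset Printing Implicit Defensive.
Import Order.TTheory GRing.Theory Num.Theory.
Import numFieldNormedType.Exports.
Local Open Scope classical_set_scope.
Local Open Scope ring_scope.

(* A complex-valued function on R is represented as a pair of real functions:
   f x = ((f x).1) + i ((f x).2). *)
Definition cfun (R : realType) := R -> (R * R)%type.

Section Defs.
Context {R : realType}.
Local Notation mu := (@lebesgue_measure R).

Definition csq (z : R * R) : R := z.1 ^+ 2 + z.2 ^+ 2.

Definition csub (f g : cfun R) : cfun R := fun x => ((f x).1 - (g x).1, (f x).2 - (g x).2).

Definition L2norm2 (f : cfun R) : \bar R := (\int[mu]_x (csq (f x))%:E)%E.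

Definition cL2 (f : cfun R) : Prop :=
  measurable_fun setT (fun x => (f x).1) /\ measurable_fun setT (fun x => (f x).2) /\
  (L2norm2 f < +oo)%E.

Definition L2norm (f : cfun R) : R := Num.sqrt (fine (L2norm2 f)).

(* Truncated Fourier transform
   (1/sqrt(2 pi)) \int_{-n}^{n} f(x) e^{-i xi x} dx, split in real/imaginary parts:
   (f1 + i f2)(cos - i sin) = (f1 cos + f2 sin) + i (f2 cos - f1 sin). *)
Definition FT_trunc (f : cfun R) (n : nat) : cfun R := fun xi =>
  ((Num.sqrt (2 * pi))^-1 *
     (\int[mu]_(x in `[- n%:R, n%:R]) ((f x).1 * cos (xi * x) + (f x).2 * sin (xi * x))),
   (Num.sqrt (2 * pi))^-1 *
     (\int[mu]_(x in `[- n%:R, n%:R]) ((f x).2 * cos (xi * x) - (f x).1 * sin (xi * x)))).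

(* g is the (Fourier–Plancherel) transform of f in L^2(R): the L^2-limit of the
   truncated transforms. This is the unitary extension of the Fourier transform. *)
Definition is_fourier (f g : cfun R) : Prop :=
  cL2 g /\ (fun n : nat => L2norm2 (csub (FT_trunc f n) g)) @ \oo --> 0%E.

Definition reg_mult (T p beta t xi : R) : R :=
  expR ((T - t) * xi ^+ 2) / (1 + beta * expR (p * T * xi ^+ 2)).

Definition is_reg_solution (T p beta : R) (psi : cfun R) (w : R -> R -> R * R) : Prop :=
  forall t, 0 <= t <= T ->
    cL2 (fun x => w x t) /\
    exists g, is_fourier psi g /\
      is_fourier (fun x => w x t)
        (fun xi => (reg_mult T p beta t xi * (g xi).1, reg_mult T p beta t xi * (g xi).2)).

End Defs.

(* Main.v *)
(** Everything reduces to Plancherel's identity for the L^2-limit transform: the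
    multiplier of R_beta is at most beta^((t-T)/(pT)) (with y = beta e^(pT xi^2) and
    a = (T-t)/(pT) it equals beta^(-a) y^a / (1 + y), and y^a <= 1 + y), so the estimate
    holds on the Fourier side.

    For Plancherel, let u be real and supported in a bounded interval, with cosine and
    sine transforms C and S.  By Fubini, the integral of e^(-eps xi) (C^2 + S^2) over
    xi >= 0 is the quadratic form of the Poisson kernel eps / (eps^2 + (x-y)^2).  AM-GM
    bounds this form by pi |u|^2, and for u bounded and continuous off its zero set it
    tends to pi |u|^2; such functions are dense, so C^2 + S^2 has integral pi |u|^2 on
    the half-line.  For complex functions the cross terms cancel when xi and -xi are
    added. *)
Require Import Defs.
From mathcomp Require Import all_boot all_order all_algebra.
From mathcomp Require Import all_classical all_reals all_analysis.
From mathcomp Require Import measurable_realfun.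
From mathcomp Require Import ring lra.
Set Implicit Arguments. Unset Strict Implicit. Unset Printing Implicit Defensive.
Import Order.TTheory GRing.Theory Num.Theory.
Import numFieldNormedType.Exports.
Local Open Scope classical_set_scope.
Local Open Scope ring_scope.

(** * Fubini's theorem for integrable functions coupled by a bounded kernel *)

Section FubiniBounded.
Context {R : realType}.
Local Notation mu := (@lebesgue_measure R).
Local Notation intg f := (mu.-integrable setT (EFin \o f)).
Implicit Types f g : R -> R.

(** For an integrable function the cosine and sine transforms are a priori only continuous and
    bounded, so Fubini cannot be applied to the energy integral itself. The weight e^(-eps xi)
    restores absolute convergence; its integrals against trigonometric functions have elementary
    primitives. Removing the weight is monotone convergence, which makes sense before the energy is
    known to be finite. The upper bound on the energy is also what makes the density argument work:
    it controls the energy of the error between a function and its approximant. Norms stay squared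
    until the very end. The triangle inequality takes the form (a + b)^2 <= (1 + s) a^2 + (1 + 1/s)
    b^2 with a free s > 0, which is meaningful for infinite integrals; s tends to 0 once the error
    has been made small. Test functions arise by clipping a continuous approximant and cutting it to
    an open interval. The cut may create jumps at the two endpoints, where the function vanishes;
    this is why continuity is asked only off the zero set. *)

Lemma integrable_measurable f : intg f -> measurable_fun setT f.
Proof. by move=> /measurable_int /measurable_EFinP. Qed.

Lemma integrable_mul_bounded f (h : R -> R) (M : R) :
  intg f -> measurable_fun setT h -> (forall x, `|h x| <= M) ->
  intg (fun x => f x * h x).
Proof.
move=> intf mh hM.
apply: (le_integrable measurableT _ _ (integrableZl measurableT M intf)).
- by apply/measurable_EFinP; apply: measurable_funM => //; exact: integrable_measurable.
- move=> x _ /=; rewrite lee_fin !normrM mulrC ler_wpM2r//.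
  by rewrite (le_trans (hM x))// ler_norm.
Qed.

Lemma le_normr_Rintegral_bounded f (h : R -> R) (M : R) :
  intg f -> measurable_fun setT h -> (forall x, `|h x| <= M) ->
  `|\int[mu]_x (f x * h x)| <= (\int[mu]_x `|f x|) * M.
Proof.
move=> intf mh hM; apply: (le_trans (le_normr_Rintegral measurableT _)).
  exact: integrable_mul_bounded.
have inf : intg (fun x => `|f x|) by exact: (integrable_norm intf).
rewrite -RintegralZr//; apply: le_Rintegral => //.
- by apply: integrable_norm; exact: integrable_mul_bounded.
- apply: (integrable_mul_bounded (M := `|M|) inf) => //.
- by move=> x _; rewrite normrM ler_wpM2l.
Qed.

(** By Tonelli it is enough that the iterated integral of the absolute value is at most M times the
    product of the L^1 norms. Boundedness is the feature shared by the trigonometric and the Poisson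
    kernels. *)
Lemma integrable_kernel2 f g (k : R * R -> R) (M : R) :
  intg f -> intg g -> measurable_fun setT k -> (forall z, `|k z| <= M) ->
  (mu \x mu)%E.-integrable setT (fun z => (f z.1 * (g z.2 * k z))%:E).
Proof.
move=> intf ing mk kM.
have M0 : 0 <= M by exact: le_trans (kM (0, 0)).
have mf := integrable_measurable intf; have mg := integrable_measurable ing.
apply/integrable12ltyP.
  apply/measurable_EFinP; apply: measurable_funM.
    by apply: measurableT_comp => //; exact: measurable_fst.
  by apply: measurable_funM => //; apply: measurableT_comp => //; exact: measurable_snd.
have [_ If] := integrableP _ _ _ intf; have [_ Ig] := integrableP _ _ _ ing.
have mng : measurable_fun setT (fun x => `|(g x)%:E|%E).
  by apply: measurableT_comp => //; exact/measurable_EFinP.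
have mnf : measurable_fun setT (fun x => `|(f x)%:E|%E).
  by apply: measurableT_comp => //; exact/measurable_EFinP.
set J := (\int[mu]_x `|(EFin \o g) x|)%E in Ig.
apply: (@le_lt_trans _ _ (\int[mu]_x (`|(f x)%:E| * (M%:E * J)))%E).
  apply: ge0_le_integral => //=.
  - by move=> x _; apply: integral_ge0.
  - have := @measurable_fun_fubini_tonelli_F _ _ (measurableTypeR R) (measurableTypeR R) R mu
      (fun z : R * R => `|f z.1 * (g z.2 * k z)|%:E).
    apply; last by move=> z; rewrite lee_fin.
    apply/measurable_EFinP; apply: measurableT_comp => //.
    apply: measurable_funM.
      by apply: measurableT_comp => //; exact: measurable_fst.
    by apply: measurable_funM => //; apply: measurableT_comp => //; exact: measurable_snd.
  - apply: emeasurable_funM => //.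
  - move=> x _; rewrite -ge0_integralZl//.
    rewrite -[leRHS]ge0_integralZl//=; first last.
    - by move=> y _; rewrite mule_ge0// lee_fin.
    - by apply: measurable_funeM.
    have mkx : measurable_fun setT (fun y => k (x, y)) by exact: measurableT_comp.
    apply: ge0_le_integral => //=.
    - by apply/measurable_EFinP; do 2 apply: measurableT_comp => //;
       apply: measurable_funM => //; apply: measurable_funM.
    - by do 2 apply: measurable_funeM.
    move=> y _; rewrite lee_fin !normrM ler_wpM2l// mulrC.
    by rewrite ler_wpM2r.
rewrite ge0_integralZr//; last first.
  by rewrite mule_ge0// ?lee_fin// integral_ge0.
have [Jf IJf] : J \is a fin_num /\ (\int[mu]_x `|(f x)%:E|)%E \is a fin_num.
  by split; rewrite ge0_fin_numE// integral_ge0.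
by rewrite -(fineK Jf) -(fineK IJf) -!EFinM ltry.
Qed.

Lemma integrable_kernel f g (k : R * R -> R) (M : R) :
  intg f -> intg g -> measurable_fun setT k -> (forall z, `|k z| <= M) ->
  intg (fun x => f x * \int[mu]_y (g y * k (x, y))).
Proof.
move=> intf ing mk kM.
have mg := integrable_measurable ing.
have gk x : intg (fun y => g y * k (x, y)).
  by apply: (integrable_mul_bounded (M := M)) => //; exact: measurableT_comp.
apply: eq_integrable (integrable_fubini_F (integrable_kernel2 intf ing mk kM)) => //.
move=> x _ /=; rewrite /fubini_F/=.
under eq_integral do rewrite EFinM.
rewrite integralZl//; last exact: gk.
by rewrite EFinM /Rintegral fineK//; apply: integrable_fin_num => //; exact: gk.
Qed.

(** The integrals are real-valued, so each inner integral has to be finite before the exchange can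
    be carried out in the extended reals. *)
Lemma Fubini_kernel f g (k : R * R -> R) (M : R) :
  intg f -> intg g -> measurable_fun setT k -> (forall z, `|k z| <= M) ->
  \int[mu]_x (f x * \int[mu]_y (g y * k (x, y))) =
  \int[mu]_y (g y * \int[mu]_x (f x * k (x, y))).
Proof.
move=> intf ing mk kM.
have mg := integrable_measurable ing.
have gk x : intg (fun y => g y * k (x, y)).
  by apply: (integrable_mul_bounded (M := M)) => //; exact: measurableT_comp.
have fk y : intg (fun x => f x * k (x, y)).
  by apply: (integrable_mul_bounded (M := M)) => //; exact: measurableT_comp.
have := Fubini (integrable_kernel2 intf ing mk kM) => /= E.
rewrite /Rintegral; congr fine.
transitivity (\int[mu]_x \int[mu]_y (f x * (g y * k (x, y)))%:E)%E.
  apply: eq_integral => x _.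
  rewrite EFinM fineK; last by apply: integrable_fin_num => //; exact: gk.
  by rewrite -integralZl//; exact: gk.
rewrite E; apply: eq_integral => y _.
rewrite EFinM fineK; last by apply: integrable_fin_num => //; exact: fk.
rewrite -integralZl//; last exact: fk.
by apply: eq_integral => x _; rewrite -EFinM mulrCA.
Qed.

End FubiniBounded.

(** * The exponential weight and the Poisson kernel *)

Section Kernels.
Context {R : realType}.
Local Notation mu := (@lebesgue_measure R).
Local Notation intg f := (mu.-integrable setT (EFin \o f)).

Lemma is_derive_scaled (f : R -> R) (a x d : R) :
  is_derive (a * x) 1 f d -> is_derive x 1 (fun z => f (a * z)) (a * d).
Proof.
move=> df.
have da : is_derive x 1 (fun z : R => a * z) a.
  by have := is_deriveZ a (is_derive_id x (1 : R)); rewrite /GRing.scale/= mulr1.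
by have := @is_derive1_comp R f (fun z : R => a * z) x _ _ df da; rewrite mulrC.
Qed.

Lemma ge0_integral_itvcy_is_derive (F : R -> R) (a l : R) (f : R -> R) :
  (forall x, a <= x -> 0 <= f x) -> continuous f -> F x @[x --> +oo%R] --> l ->
  (forall x, derivable F x 1 /\ 'D_1 F x = f x) ->
  (\int[mu]_(x in `[a, +oo[) (f x)%:E = (l - F a)%:E)%E.
Proof.
move=> f0 cf Fl dF; rewrite (ge0_continuous_FTC2y (l := l) f0 _ Fl)//.
- exact: continuous_subspaceT.
- by move=> x _; have [] := dF x.
- apply: cvg_at_right_filter; apply: differentiable_continuous.
  by apply/derivable1_diffP; have [] := dF a.
- by move=> x _; rewrite derive1E; have [] := dF x.
Qed.

Lemma cvg_expR_scaled (eps : R) : 0 < eps -> expR (- (eps * x)) @[x --> +oo%R] --> (0 : R).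
Proof.
move=> e0; apply: (@cvg_comp _ _ _ (fun x => eps * x) (fun x => expR (- x)) _ (pinfty_nbhs R)).
  by apply/cvgryPge => A; near=> x; rewrite -ler_pdivrMl//; near: x; exact: nbhs_pinfty_ge.
exact: cvgr_expR.
Unshelve. all: by end_near. Qed.

Lemma continuous_scaled (f : R -> R) (a : R) : continuous f -> continuous (fun x => f (a * x)).
Proof.
move=> cf x; apply: (@continuous_comp _ _ _ (fun x => a * x) f); last exact: cf.
by apply: cvgM; [exact: cvg_cst|exact: cvg_id].
Qed.

Lemma continuous_mulf (f g : R -> R) : continuous f -> continuous g ->
  continuous (fun x => f x * g x).
Proof. by move=> cf cg x; apply: cvgM; [exact: cf|exact: cg]. Qed.

Lemma continuous_addf (f g : R -> R) : continuous f -> continuous g ->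
  continuous (fun x => f x + g x).
Proof. by move=> cf cg x; apply: cvgD; [exact: cf|exact: cg]. Qed.

Lemma is_derive_expRN (eps x : R) :
  is_derive x 1 (fun z => expR (- (eps * z))) (- (eps * expR (- (eps * x)))).
Proof.
have := @is_derive_scaled (fun z => expR z) (- eps) x _ (is_derive_expR _).
by rewrite !mulNr; under eq_fun do rewrite mulNr.
Qed.

Lemma continuous_expRN (eps : R) : continuous (fun x => expR (- (eps * x))).
Proof.
move=> x; apply: differentiable_continuous; apply/derivable1_diffP.
by have [] := is_derive_expRN eps x.
Qed.

Lemma integral_itv0y_expRN (eps : R) : 0 < eps ->
  (\int[mu]_(x in `[0%R, +oo[) (expR (- (eps * x)))%:E = (eps^-1)%:E)%E.
Proof.
move=> e0.
have := @ge0_integral_itvcy_is_derive (fun x => - eps^-1 * expR (- (eps * x))) 0 0.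
move=> /(_ (fun x => expR (- (eps * x)))) ->.
- by rewrite mulr0 oppr0 expR0 mulr1 opprK add0r.
- by move=> x _; exact: expR_ge0.
- exact: continuous_expRN.
- by rewrite -(mulr0 (- eps^-1)); apply: cvgM; [exact: cvg_cst|exact: cvg_expR_scaled].
- move=> x; have [dE ->] := is_deriveZ (- eps^-1) (is_derive_expRN eps x); split => //.
  by rewrite /GRing.scale/= mulrNN mulKf ?gt_eqF.
Qed.

(** Extension by zero keeps every later integral on the whole line, where the Fubini lemmas are
    stated. *)
Definition damping (eps : R) : R -> R := (fun x => expR (- (eps * x))) \_ `[0%R, +oo[.

Lemma measurable_expRN eps : measurable_fun setT (fun x : R => expR (- (eps * x))).
Proof. by apply: continuous_measurable_fun; exact: continuous_expRN. Qed.

Lemma integrable_itv0y_expRN (eps : R) : 0 < eps ->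
  mu.-integrable `[0%R, +oo[ (EFin \o (fun x => expR (- (eps * x)))).
Proof.
move=> e0; apply/integrableP; split.
  by apply/measurable_EFinP; apply: measurable_funTS; exact: measurable_expRN.
under eq_integral do rewrite /= ger0_norm ?expR_ge0//.
by rewrite integral_itv0y_expRN// ltry.
Qed.

Lemma integrable_damping (eps : R) : 0 < eps -> intg (damping eps).
Proof.
move=> /integrable_itv0y_expRN /integrable_mkcond => /(_ (measurable_itv _)).
by rewrite /damping -restrict_EFin.
Qed.

(** This is pi times the Poisson kernel of the upper half-plane at height eps; its total mass is
    pi. *)
Definition poisson (eps u : R) : R := eps / (eps ^+ 2 + u ^+ 2).

(** The summand 1 makes the integrand nonnegative, as the fundamental theorem on a half-line is used
    in its nonnegative form; the damped cosine alone may change sign. *)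
Lemma integral_itv0y_expRN_cos (eps u : R) : 0 < eps ->
  (\int[mu]_(x in `[0%R, +oo[) (expR (- (eps * x)) * (1 + cos (u * x)))%:E =
   (eps^-1 + poisson eps u)%:E)%E.
Proof.
move=> e0.
have d0 : eps ^+ 2 + u ^+ 2 != 0.
  by rewrite gt_eqF// ltr_wpDr ?sqr_ge0// exprn_gt0.
(* e^(-eps x) G(x) is the primitive: its first term accounts for e^(-eps x), its second for e^(-eps
   x) cos (u x). *)
pose G x := - eps^-1 + (eps ^+ 2 + u ^+ 2)^-1 * (u * sin (u * x) - eps * cos (u * x)).
have := @ge0_integral_itvcy_is_derive (fun x => expR (- (eps * x)) * G x) 0 0.
move=> /(_ (fun x => expR (- (eps * x)) * (1 + cos (u * x)))) ->.
- rewrite /G !mulr0 oppr0 expR0 mul1r sin0 cos0 /poisson; congr EFin.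
  by field; rewrite d0 gt_eqF.
- by move=> x _; rewrite mulr_ge0 ?expR_ge0.
- apply: continuous_mulf; first exact: continuous_expRN.
  apply: continuous_addf; first by move=> ?; exact: cvg_cst.
  exact: (continuous_scaled (@continuous_cos R)).
- apply/cvgr0Pnorm_le => e e1.
  (* [G] oscillates but is bounded by [B], so the limit at infinity comes from the decay of the
     exponential. *)
  pose B := eps^-1 + (eps ^+ 2 + u ^+ 2)^-1 * (`|u| + eps).
  have GB x : `|G x| <= B.
    rewrite /G (le_trans (ler_normD _ _))// normrN lerD//.
      by rewrite ger0_norm// invr_ge0 ltW.
    rewrite normrM ger0_norm ?invr_ge0; last by rewrite addr_ge0// sqr_ge0.
    rewrite ler_wpM2l ?invr_ge0 ?addr_ge0 ?sqr_ge0//.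
    rewrite (le_trans (ler_normB _ _))// !normrM (ger0_norm (ltW e0)) lerD//.
      by rewrite ler_piMr// sin_max.
    by rewrite ler_piMr ?(ltW e0)// cos_max.
  have B0 : 0 < B.
    by rewrite /B ltr_wpDr ?invr_gt0// mulr_ge0// ?invr_ge0 addr_ge0 ?sqr_ge0// ltW.
  have := cvg_expR_scaled e0 => /cvgr0Pnorm_le /(_ (e / B) (divr_gt0 e1 B0)).
  apply: filterS => x ex; rewrite normrM (le_trans (ler_pM _ _ ex (GB x)))//.
  by rewrite divfK// gt_eqF.
- move=> x.
  have ds : is_derive x 1 (fun z => sin (u * z)) (u * cos (u * x)).
    exact: (@is_derive_scaled sin).
  have dc : is_derive x 1 (fun z => cos (u * z)) (u * - sin (u * x)).
    exact: (@is_derive_scaled cos).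
  have dG : is_derive x 1 G ((eps ^+ 2 + u ^+ 2)^-1 * (u * (u * cos (u * x)) - eps * (u * - sin (u * x)))).
    have := is_deriveD (is_derive_cst (- eps^-1) x 1)
      (is_deriveZ (eps ^+ 2 + u ^+ 2)^-1 (is_deriveB (is_deriveZ u ds) (is_deriveZ eps dc))).
    by rewrite add0r.
  have [dE ->] := is_deriveM (is_derive_expRN eps x) dG; split => //.
  rewrite /GRing.scale/= /G.
  by field; rewrite d0 gt_eqF.
Qed.

(** The auxiliary term 1/eps is subtracted again; what remains is the Laplace transform of the
    cosine. *)
Lemma Rintegral_damping_cos (eps u : R) : 0 < eps ->
  \int[mu]_x (damping eps x * cos (u * x)) = poisson eps u.
Proof.
move=> e0.
have ic := integrable_itv0y_expRN e0.
have icc : mu.-integrable `[0%R, +oo[ (EFin \o (fun x => expR (- (eps * x)) * cos (u * x))).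
  apply: (le_integrable _ _ _ ic) => //.
    apply/measurable_EFinP; apply: measurable_funTS; apply: continuous_measurable_fun.
    apply: continuous_mulf; first exact: continuous_expRN.
    exact: (continuous_scaled (@continuous_cos R)).
  by move=> x _; rewrite /= lee_fin normrM ler_piMr// cos_max.
have -> : (fun x => damping eps x * cos (u * x)) =
   ((fun x => expR (- (eps * x)) * cos (u * x)) \_ `[0%R, +oo[).
  by apply/funext => x; rewrite /damping !patchE; case: ifP => //; rewrite mul0r.
rewrite -Rintegral_mkcond.
have := integral_itv0y_expRN_cos u e0.
under eq_integral do rewrite mulrDr mulr1 EFinD.
rewrite integralD_EFin// integral_itv0y_expRN// -[X in (_ + X)%E]fineK; last first.
  exact: integrable_fin_num.
by rewrite -EFinD => -[] /addrI.
Qed.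

Lemma poisson_gt0 eps u : 0 < eps -> 0 < poisson eps u.
Proof. by move=> e0; rewrite divr_gt0// ltr_wpDr ?sqr_ge0// exprn_gt0. Qed.

Lemma continuous_poisson eps : 0 < eps -> continuous (poisson eps).
Proof.
move=> e0; apply: continuous_mulf; first by move=> ?; exact: cvg_cst.
move=> u; apply: cvgV.
  by rewrite gt_eqF// ltr_wpDr ?sqr_ge0// exprn_gt0.
by apply: cvgD; [exact: cvg_cst|exact: exprn_continuous].
Qed.

Lemma poissonB eps x y : poisson eps (x - y) = poisson eps (y - x).
Proof. by rewrite /poisson -opprB sqrrN. Qed.

Lemma poisson_le eps u : 0 < eps -> poisson eps u <= eps^-1.
Proof.
move=> e0; rewrite /poisson ler_pdivrMr; last by rewrite ltr_wpDr ?sqr_ge0// exprn_gt0.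
rewrite mulrDr expr2 mulKf ?gt_eqF// lerDl mulr_ge0 ?sqr_ge0// invr_ge0; exact: ltW.
Qed.

Lemma integral_oneDsqrV : (\int[mu]_x ((1 + x ^+ 2)^-1)%:E = (pi : R)%:E)%E.
Proof.
rewrite (@ge0_symfun_integralT R (fun x => (1 + x ^+ 2)^-1)).
- rewrite -set_itvcy integral0y_oneDsqr -EFinM; congr EFin.
  by rewrite mulrCA divff// mulr1.
- by move=> x; rewrite invr_ge0 addr_ge0// sqr_ge0.
- exact: continuous_oneDsqrV.
- by move=> x /=; rewrite sqrrN.
Qed.

(** The substitution z = (y - x) / eps, oriented so as to be increasing, reduces the kernel to 1 /
    (1 + z^2). *)
Lemma integral_poisson (eps x : R) : 0 < eps ->
  (\int[mu]_y (poisson eps (x - y))%:E = (pi : R)%:E)%E.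
Proof.
move=> e0; pose F (y : R) := eps^-1 * (y - x).
have dF (y : R) : is_derive y 1 F eps^-1.
  have := is_deriveZ eps^-1 (is_deriveB (is_derive_id y 1) (is_derive_cst x y 1)).
  by rewrite subr0 /GRing.scale/= mulr1.
have F' : derive1 F = cst eps^-1.
  by apply/funext => y; rewrite derive1E; have [] := dF y.
rewrite -integral_oneDsqrV.
rewrite [RHS](@increasing_ge0_integration_by_substitutionT R F (fun x => (1 + x ^+ 2)^-1)).
- apply: eq_integral => y _; rewrite F' /poisson; congr EFin.
  have ? : eps != 0 by rewrite gt_eqF.
  have h1 : eps ^+ 2 + (x - y) ^+ 2 != 0 by rewrite gt_eqF// ltr_wpDr ?sqr_ge0// exprn_gt0.
  rewrite [LHS](_ : _ = ((eps ^+ 2 + (x - y) ^+ 2) / eps)^-1); last by rewrite invf_div.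
  rewrite [RHS](_ : _ = ((1 + (eps^-1 * (y - x)) ^+ 2) * eps)^-1); last by rewrite invfM.
  by congr (_^-1); field.
- by move=> a b ab; rewrite /F ltr_pM2l ?invr_gt0// ltrD2r.
- by rewrite F' => ?; exact: cvg_cst.
- by rewrite F'; apply: is_cvg_cst.
- by rewrite F'; apply: is_cvg_cst.
- by move=> y; have [] := dF y.
- apply/cvgrNyPle => A; near=> y.
  rewrite /F mulrC ler_pdivrMr// lerBlDr; near: y; apply: nbhs_ninfty_le; exact: num_real.
- apply/cvgryPge => A; near=> y.
  rewrite /F mulrC ler_pdivlMr// lerBrDr; near: y; apply: nbhs_pinfty_ge; exact: num_real.
- exact: continuous_oneDsqrV.
- by move=> y; rewrite invr_ge0 addr_ge0// sqr_ge0.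
Unshelve. all: by end_near. Qed.

Lemma integrable_poisson (eps x : R) : 0 < eps -> intg (fun y => poisson eps (x - y)).
Proof.
move=> e0; apply/integrableP; split.
  apply/measurable_EFinP; apply: measurableT_comp; last exact: measurable_funB.
  by apply: continuous_measurable_fun; exact: continuous_poisson.
under eq_integral do rewrite /= ger0_norm ?(ltW (poisson_gt0 _ e0))//.
by rewrite integral_poisson// ltry.
Qed.

End Kernels.

(** * Cosine and sine transforms; the damped energy as a Poisson form *)

Section TrigIntegral.
Context {R : realType}.
Local Notation mu := (@lebesgue_measure R).
Local Notation intg f := (mu.-integrable setT (EFin \o f)).
Implicit Types f phi : R -> R.

(** The profile [phi] is a parameter so that cosine and sine share one treatment, based on
    continuity and the bound 1. *)
Definition trig_integral phi f (xi : R) : R := \int[mu]_x (f x * phi (xi * x)).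

Section Generic.
Context {phi : R -> R}.
Hypotheses (cphi : continuous phi) (phi1 : forall x, `|phi x| <= 1).

Let mphi : measurable_fun setT phi. Proof. exact: continuous_measurable_fun. Qed.

Let mk : measurable_fun setT (fun z : R * R => phi (z.1 * z.2)).
Proof.
apply: measurableT_comp => //.
by apply: measurable_funM; [exact: measurable_fst|exact: measurable_snd].
Qed.

Let mk' : measurable_fun setT (fun z : R * R => phi (z.2 * z.1)).
Proof.
apply: measurableT_comp => //.
by apply: measurable_funM; [exact: measurable_snd|exact: measurable_fst].
Qed.

Let mphix (xi : R) : measurable_fun setT (fun x : R => phi (xi * x)).
Proof. by apply: continuous_measurable_fun; exact: continuous_scaled. Qed.

Lemma integrable_trig f (xi : R) : intg f -> intg (fun x => f x * phi (xi * x)).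
Proof. by move=> intf; exact: (integrable_mul_bounded (M := 1)). Qed.

Lemma trig_integral_le f (xi : R) : intg f ->
  `|trig_integral phi f xi| <= \int[mu]_x `|f x|.
Proof.
by move=> intf; rewrite -[leRHS]mulr1; exact: le_normr_Rintegral_bounded.
Qed.

Lemma continuous_trig_integral f : intg f -> continuous (trig_integral phi f).
Proof.
move=> intf xi.
have := @continuity_under_integral R _ (measurableTypeR R) mu
  (fun xi x => f x * phi (xi * x)) setT measurableT (xi - 1) (xi + 1).
apply.
- by move=> x _; exact: integrable_trig.
- apply: aeW => x _ y _.
  apply: (continuous_mulf (f := fun _ => f x) (g := fun y => phi (y * x))).
    by move=> ?; exact: cvg_cst.
  under eq_fun do rewrite mulrC.
  exact: continuous_scaled.
- exact: (integrable_norm intf).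
- move=> x _; apply: aeW => y _; rewrite normrM ler_piMr//.
- by rewrite inE/= in_itv/= ltrBlDr !ltrDl ltr01.
Qed.

Lemma measurable_trig_integral f : intg f -> measurable_fun setT (trig_integral phi f).
Proof. by move=> intf; apply: continuous_measurable_fun; exact: continuous_trig_integral. Qed.

Variable eps : R.
Hypothesis e0 : 0 < eps.

Let id1 : intg (damping eps). Proof. exact: integrable_damping. Qed.

Lemma integrable_damped_trig f : intg f ->
  intg (fun xi => damping eps xi * trig_integral phi f xi).
Proof.
move=> intf; apply: (integrable_mul_bounded (M := \int[mu]_x `|f x|)) => //.
- exact: measurable_trig_integral.
- by move=> x; exact: trig_integral_le.
Qed.

Lemma integrable_damped_trig_sqr f : intg f ->
  intg (fun xi => damping eps xi * trig_integral phi f xi * trig_integral phi f xi).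
Proof.
move=> intf; apply: (integrable_mul_bounded (M := \int[mu]_x `|f x|)) => //.
- exact: integrable_damped_trig.
- exact: measurable_trig_integral.
- by move=> x; exact: trig_integral_le.
Qed.

(** One of the two transforms is written out as an integral and exchanged with the integral in xi;
    [damped_trig_inner] does the same for the other one. *)
Lemma damped_trig_sqr f : intg f ->
  \int[mu]_xi (damping eps xi * trig_integral phi f xi * trig_integral phi f xi) =
  \int[mu]_x (f x * \int[mu]_xi (damping eps xi * trig_integral phi f xi * phi (xi * x))).
Proof.
move=> intf.
exact: (Fubini_kernel (integrable_damped_trig intf) intf mk (fun z => phi1 (z.1 * z.2))).
Qed.

Lemma integrable_damped_trig_outer f : intg f ->
  intg (fun x => f x * \int[mu]_xi (damping eps xi * trig_integral phi f xi * phi (xi * x))).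
Proof.
move=> intf.
exact: (integrable_kernel intf (integrable_damped_trig intf) mk' (fun z => phi1 (z.2 * z.1))).
Qed.

Let id2 (x : R) : intg (fun xi => damping eps xi * phi (xi * x)).
Proof.
apply: (integrable_mul_bounded (M := 1)) => //.
by under eq_fun do rewrite mulrC; exact: mphix.
Qed.

Lemma damped_trig_inner f (x : R) : intg f ->
  \int[mu]_xi (damping eps xi * trig_integral phi f xi * phi (xi * x)) =
  \int[mu]_y (f y * \int[mu]_xi (damping eps xi * phi (xi * x) * phi (xi * y))).
Proof.
move=> intf; under eq_Rintegral do rewrite mulrAC.
exact: (Fubini_kernel (id2 x) intf mk (fun z => phi1 (z.1 * z.2))).
Qed.

Lemma integrable_damped_trig_inner f (x : R) : intg f ->
  intg (fun y => f y * \int[mu]_xi (damping eps xi * phi (xi * x) * phi (xi * y))).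
Proof.
move=> intf.
exact: (integrable_kernel intf (id2 x) mk' (fun z => phi1 (z.2 * z.1))).
Qed.

Lemma integrable_damping_prod (x y : R) :
  intg (fun xi => damping eps xi * phi (xi * x) * phi (xi * y)).
Proof.
apply: (integrable_mul_bounded (M := 1)) => //.
by under eq_fun do rewrite mulrC; exact: mphix.
Qed.

End Generic.

Lemma sin_norm_le1 (x : R) : `|sin x| <= 1. Proof. exact: sin_max. Qed.
Lemma cos_norm_le1 (x : R) : `|cos x| <= 1. Proof. exact: cos_max. Qed.

Local Notation C := (trig_integral cos).
Local Notation S := (trig_integral sin).
Let cs := @continuous_sin R.
Let cc := @continuous_cos R.
Let s1 := sin_norm_le1.
Let c1 := cos_norm_le1.

(** After both exchanges the cosine and sine parts merge through cos a cos b + sin a sin b = cos (a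
    - b), leaving the damped integral of cos (xi (x - y)). The two parts are added level by level,
    each level requiring its own integrability. *)
Lemma damped_trig_poisson (eps : R) f : 0 < eps -> intg f ->
  \int[mu]_xi (damping eps xi * (C f xi ^+ 2 + S f xi ^+ 2)) =
  \int[mu]_x (f x * \int[mu]_y (f y * poisson eps (x - y))).
Proof.
move=> e0 intf.
under eq_Rintegral do rewrite mulrDr !expr2 !mulrA.
rewrite RintegralD//; [|exact: (integrable_damped_trig_sqr cc c1)|exact: (integrable_damped_trig_sqr cs s1)].
rewrite (damped_trig_sqr cc c1)// (damped_trig_sqr cs s1)//.
rewrite -RintegralD//; [|exact: (integrable_damped_trig_outer cc c1)|exact: (integrable_damped_trig_outer cs s1)].
apply: eq_Rintegral => x _; rewrite -mulrDr; congr (_ * _).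
rewrite (damped_trig_inner cc c1)// (damped_trig_inner cs s1)//.
rewrite -RintegralD//; [|exact: (integrable_damped_trig_inner cc c1)|exact: (integrable_damped_trig_inner cs s1)].
apply: eq_Rintegral => y _; rewrite -mulrDr; congr (_ * _).
rewrite -RintegralD//; [|exact: (integrable_damping_prod cc c1)|exact: (integrable_damping_prod cs s1)].
rewrite -Rintegral_damping_cos//; apply: eq_Rintegral => xi _.
by rewrite mulrBl cosB ![_ * xi]mulrC mulrDr !mulrA.
Qed.

Lemma integrable_damped_energy (eps : R) f : 0 < eps -> intg f ->
  intg (fun xi => damping eps xi * (C f xi ^+ 2 + S f xi ^+ 2)).
Proof.
move=> e0 intf.
have := integrableD measurableT (integrable_damped_trig_sqr cc c1 e0 intf)
  (integrable_damped_trig_sqr cs s1 e0 intf).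
by apply: eq_integrable => // x _ /=; rewrite -EFinD -!mulrA -mulrDr !expr2.
Qed.

End TrigIntegral.

(** * The half-line energy and its upper bound *)

Section Energy.
Context {R : realType}.
Local Notation mu := (@lebesgue_measure R).
Local Notation intg f := (mu.-integrable setT (EFin \o f)).
Implicit Types f g : R -> R.
Local Notation C := (trig_integral cos).
Local Notation S := (trig_integral sin).

Local Notation Rp := (`[(0 : R), +oo[%classic).

(** The half-line is the range on which e^(-eps xi) is a damping factor; for integrable real f the
    density is even, so this is half of the full integral. The value is extended real because
    finiteness has to be proved. *)
Definition energy f : \bar R :=
  (\int[mu]_(xi in `[0%R, +oo[) (C f xi ^+ 2 + S f xi ^+ 2)%:E)%E.

Lemma measurable_energy_density f : intg f ->
  measurable_fun setT (fun xi => C f xi ^+ 2 + S f xi ^+ 2).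
Proof.
move=> intf; apply: measurable_funD; apply: measurable_funX.
  exact: (measurable_trig_integral (@continuous_cos R) cos_norm_le1).
exact: (measurable_trig_integral (@continuous_sin R) sin_norm_le1).
Qed.

Lemma energy_density_ge0 f xi : 0 <= C f xi ^+ 2 + S f xi ^+ 2.
Proof. by rewrite addr_ge0 ?sqr_ge0. Qed.

(** Monotone convergence: for xi >= 0 the weight increases to 1 as eps = 1/(n+1) decreases to 0, so
    an infinite limit would be allowed as well. *)
Lemma cvg_damped_energy f : intg f ->
  (\int[mu]_x (damping n.+1%:R^-1 x * (C f x ^+ 2 + S f x ^+ 2)))%:E @[n --> \oo]
    --> energy f.
Proof.
move=> intf.
pose g (n : nat) (x : R) := (expR (- (n.+1%:R^-1 * x)) * (C f x ^+ 2 + S f x ^+ 2))%:E.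
have mg (n : nat) : measurable_fun Rp (g n).
  apply/measurable_EFinP; apply: measurable_funTS; apply: measurable_funM.
    exact: measurable_expRN.
  exact: measurable_energy_density.
have g0 (n : nat) (x : R) : Rp x -> (0 <= g n x)%E.
  by move=> _; rewrite lee_fin mulr_ge0 ?expR_ge0 ?energy_density_ge0.
have ndg (x : R) : Rp x -> nondecreasing_seq (g^~ x).
  rewrite /= in_itv/= andbT => x0 m n mn.
  rewrite lee_fin ler_wpM2r ?energy_density_ge0// ler_expR lerN2 ler_wpM2r//.
  by rewrite lef_pV2 ?posrE// ler_nat.
have := @cvg_monotone_convergence _ (measurableTypeR R) R mu Rp (measurable_itv _) g mg g0 ndg.
set l := (X in _ --> X -> _).
have -> : l = energy f.
  apply: eq_integral => x _; apply/cvg_lim => //.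
  apply: cvg_EFin; first exact: nearW.
  rewrite -[X in _ --> X]mul1r; apply: cvgM; last exact: cvg_cst.
  rewrite [X in _ --> X](_ : 1 = expR (- (x * 0))); last by rewrite mulr0 oppr0 expR0.
  have cE : expR (- (z * x)) @[z --> nbhs (0 : R)] --> expR (- (x * 0)).
    have -> : (fun z : R => expR (- (z * x))) = (fun z => expR (- (x * z))).
      by apply/funext => z; rewrite mulrC.
    exact: continuous_expRN.
  exact: (cvg_comp _ _ (@cvg_harmonic R) cE).
apply: cvg_trans; apply: near_eq_cvg; apply: nearW => n.
rewrite /Rintegral fineK; last first.
  by apply: integrable_fin_num => //; exact: integrable_damped_energy.
rewrite [LHS]integral_mkcond; apply: eq_integral => x _.
by rewrite /damping !patchE; case: ifP => // _; rewrite mul0r.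
Qed.

Lemma Rintegral_poisson (eps x : R) : 0 < eps -> \int[mu]_y poisson eps (x - y) = pi.
Proof. by move=> e0; rewrite /Rintegral integral_poisson. Qed.

Lemma measurable_poisson eps : 0 < eps -> measurable_fun setT (@poisson R eps).
Proof. by move=> e0; apply: continuous_measurable_fun; exact: continuous_poisson. Qed.

Lemma poisson_norm_le (eps u : R) : 0 < eps -> `|poisson eps u| <= eps^-1.
Proof. by move=> e0; rewrite ger0_norm ?poisson_le// ltW// poisson_gt0. Qed.

Lemma measurable_poisson2 eps : 0 < eps ->
  measurable_fun setT (fun z : R * R => poisson eps (z.1 - z.2)).
Proof.
move=> e0; apply: measurableT_comp; first exact: measurable_poisson.
by apply: measurable_funB; [exact: measurable_fst|exact: measurable_snd].
Qed.

Lemma integrable_mul_poisson f (eps x : R) : 0 < eps -> intg f ->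
  intg (fun y => f y * poisson eps (x - y)).
Proof.
move=> e0 intf; apply: (integrable_mul_bounded (M := eps^-1)) => //.
  by apply: measurableT_comp; [exact: measurable_poisson|exact: measurable_funB].
by move=> y; exact: poisson_norm_le.
Qed.

(** Tonelli moves the integral in x inside, where, by symmetry of the kernel, it has mass pi for
    every y. *)
Lemma integral_poisson_conv f (eps : R) : 0 < eps -> intg f -> (forall x, 0 <= f x) ->
  (\int[mu]_x (\int[mu]_y (f y * poisson eps (x - y)))%:E = (pi * \int[mu]_x f x)%:E)%E.
Proof.
move=> e0 intf f0.
have mf := integrable_measurable intf.
transitivity (\int[mu]_x \int[mu]_y (f y * poisson eps (x - y))%:E)%E.
  apply: eq_integral => x _; rewrite /Rintegral fineK//.
  by apply: integrable_fin_num => //; exact: integrable_mul_poisson.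
have := @fubini_tonelli _ _ (measurableTypeR R) (measurableTypeR R) R mu mu
  (fun z => (f z.2 * poisson eps (z.1 - z.2))%:E).
move=> /= ->; first last.
- by move=> z; rewrite lee_fin mulr_ge0// ltW// poisson_gt0.
- apply/measurable_EFinP; apply: measurable_funM; last exact: measurable_poisson2.
  by apply: measurableT_comp => //; exact: measurable_snd.
transitivity (\int[mu]_y (pi%:E * (f y)%:E))%E.
  apply: eq_integral => y _; under eq_integral do rewrite poissonB EFinM.
  by rewrite integralZl ?integral_poisson 1?muleC//; exact: integrable_poisson.
by rewrite integralZl// EFinM /Rintegral fineK//; exact: integrable_fin_num.
Qed.

(** [integrable_kernel] does not cover this case, as there is no integrable weight in x;
    integrability comes from positivity and the finite total mass. *)
Lemma integrable_poisson_conv f (eps : R) : 0 < eps -> intg f -> (forall x, 0 <= f x) ->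
  intg (fun x => \int[mu]_y (f y * poisson eps (x - y))).
Proof.
move=> e0 intf f0; have mf := integrable_measurable intf.
have c0 x : 0 <= \int[mu]_y (f y * poisson eps (x - y)).
  by apply: Rintegral_ge0 => y _; rewrite mulr_ge0// ltW// poisson_gt0.
apply/integrableP; split; last first.
  under eq_integral do rewrite /= ger0_norm//.
  by rewrite integral_poisson_conv// ltry.
have -> : EFin \o (fun x => \int[mu]_y (f y * poisson eps (x - y))) =
    (fun x => \int[mu]_y (f y * poisson eps (x - y))%:E)%E.
  apply/funext => x; rewrite /= /Rintegral fineK//.
  by apply: integrable_fin_num => //; exact: integrable_mul_poisson.
apply: (@measurable_fun_fubini_tonelli_F _ _ (measurableTypeR R) (measurableTypeR R) R mu
  (fun z => (f z.2 * poisson eps (z.1 - z.2))%:E)).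
- apply/measurable_EFinP; apply: measurable_funM; last exact: measurable_poisson2.
  by apply: measurableT_comp => //; exact: measurable_snd.
- by move=> z; rewrite lee_fin mulr_ge0// ltW// poisson_gt0.
Qed.

Lemma poisson_form_le f (eps : R) : 0 < eps -> intg f -> intg (fun x => f x ^+ 2) ->
  \int[mu]_x (f x * \int[mu]_y (f y * poisson eps (x - y))) <= pi * \int[mu]_x (f x ^+ 2).
Proof.
move=> e0 intf intf2.
have f2 x : 0 <= f x ^+ 2 by exact: sqr_ge0.
have ic := integrable_poisson_conv e0 intf2 f2.
have Ec := integral_poisson_conv e0 intf2 f2.
(* These are the two halves of the AM-GM majorant: in the first the kernel has been integrated in y,
   the second remains a convolution whose total mass is known. *)
have i1 : intg (fun x => f x ^+ 2 * (pi / 2)).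
  exact: (integrable_mul_bounded (h := cst (pi / 2)) (M := `|pi / 2|)).
have i2 : intg (fun x => (\int[mu]_y (f y ^+ 2 * poisson eps (x - y))) * 2^-1).
  exact: (integrable_mul_bounded (h := cst 2^-1) (M := `|2^-1|)).
apply: (@le_trans _ _ (\int[mu]_x (f x ^+ 2 * (pi / 2) +
          (\int[mu]_y (f y ^+ 2 * poisson eps (x - y))) * 2^-1))).
  apply: le_Rintegral => //.
  - apply: (@integrable_kernel R f f (fun z => poisson eps (z.1 - z.2)) eps^-1) => //.
      exact: measurable_poisson2.
    by move=> z; exact: poisson_norm_le.
  - have := integrableD measurableT i1 i2.
    by apply: eq_integrable => // x _ /=; rewrite EFinD.
  - move=> x _.
    have ip : intg (fun y => poisson eps (x - y)) by exact: integrable_poisson.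
    have j0 := integrable_mul_poisson x e0 intf.
    have j1 : intg (fun y => f x ^+ 2 / 2 * poisson eps (x - y)).
      exact: (@integrableZl _ _ _ mu setT measurableT _ (EFin \o (fun y => poisson eps (x - y)))).
    have j2 := integrable_mul_poisson x e0 intf2.
    have j3 : intg (fun y => f y ^+ 2 * poisson eps (x - y) * 2^-1).
      exact: (integrable_mul_bounded (h := cst 2^-1) (M := `|2^-1|)).
    rewrite -RintegralZl// -(Rintegral_poisson x e0).
    rewrite mulrCA mulrC -RintegralZl//; last first.
    rewrite -RintegralZr// -RintegralD//.
    apply: le_Rintegral => //.
    + exact: (@integrableZl _ _ _ mu setT measurableT _ (EFin \o (fun y => f y * poisson eps (x - y)))).
    + have := integrableD measurableT j1 j3.
      by apply: eq_integrable => // y _ /=; rewrite EFinD.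
    + move=> y _; have P0 := ltW (poisson_gt0 (x - y) e0).
      (* Expanding the square gives f(x) f(y) <= (f(x)^2 + f(y)^2) / 2 with the kernel as weight. *)
      have : 0 <= (f x - f y) ^+ 2 * poisson eps (x - y) by rewrite mulr_ge0// sqr_ge0.
      set P := poisson _ _; set a := f x; set b := f y; nra.
rewrite RintegralD// !RintegralZr//.
have -> : \int[mu]_x \int[mu]_y (f y ^+ 2 * poisson eps (x - y)) = pi * \int[mu]_x (f x ^+ 2).
  by rewrite [LHS]/Rintegral Ec.
by rewrite le_eqVlt; apply/orP; left; apply/eqP; field.
Qed.

(** The bound is uniform in eps and so survives the limit. No support condition is imposed, so it
    applies to approximation errors and shows that energies are finite. *)
Lemma energy_le f : intg f -> intg (fun x => f x ^+ 2) ->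
  (energy f <= (pi * \int[mu]_x (f x ^+ 2))%:E)%E.
Proof.
move=> intf intf2; apply: cvge_le (cvg_damped_energy intf); apply: nearW => n.
by rewrite lee_fin damped_trig_poisson// poisson_form_le.
Qed.

End Energy.

(** * The Poisson kernel as an approximate identity *)

Section ApproximateIdentity.
Context {R : realType}.
Local Notation mu := (@lebesgue_measure R).
Local Notation intg f := (mu.-integrable setT (EFin \o f)).
Implicit Types f g : R -> R.

(* Away from the diagonal [poisson eps] is dominated by a multiple [O(eps)] of
   [poisson 1], so the tail of the convolution needs no change of variables. *)
Lemma poisson_tail (eps eta u : R) : 0 < eps -> 0 < eta -> eta <= `|u| ->
  poisson eps u <= eps * (1 + eta ^- 2) * poisson 1 u.
Proof.
move=> e0 eta0 etau.
have u2 : eta ^+ 2 <= u ^+ 2 by rewrite -(real_normK (num_real u)) lerXn2r ?nnegrE// ltW.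
have eta2 : 0 < eta ^+ 2 by rewrite exprn_gt0.
have u20 : 0 < u ^+ 2 by exact: lt_le_trans u2.
rewrite /poisson expr1n mul1r -mulrA ler_wpM2l ?(ltW e0)//.
rewrite -[leLHS]mul1r ler_pdivrMr ?ltr_wpDl ?sqr_ge0//.
rewrite mulrAC ler_pdivlMr; last by rewrite ltr_wpDr ?ltr01 ?ltW.
rewrite mul1r mulrDl mul1r.
have k : 1 <= eta ^- 2 * u ^+ 2 by rewrite mulrC ler_pdivlMr ?mul1r.
have i0 : 0 <= eta ^- 2 by rewrite invr_ge0 ltW.
have := sqr_ge0 eps; set v := u ^+ 2 in u20 k *; set i := eta ^- 2 in k i0 *; nra.
Qed.

Lemma cvg_poisson_conv g (M x : R) : intg g -> (forall y, `|g y| <= M) ->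
  {for x, continuous g} ->
  \int[mu]_y (g y * poisson n.+1%:R^-1 (x - y)) @[n --> \oo] --> pi * g x.
Proof.
move=> ing gM cg; apply/cvgrPdist_le => e e0.
have M0 : 0 <= M by exact: le_trans (gM 0).
have pi0 := pi_gt0 R.
(* The kernel has mass pi, so an oscillation of at most [d] near x costs at most e / 2. *)
pose d := e / (2 * pi).
have d0 : 0 < d by rewrite divr_gt0// mulr_gt0.
have [eta /= eta0 geta] : exists2 eta, 0 < eta & forall y, `|x - y| < eta -> `|g x - g y| <= d.
  by move/cvgrPdist_le : cg => /(_ d d0) /nbhs_ballP[eta /= eta0 H]; exists eta.
have i0 : 0 <= eta ^- 2 by rewrite invr_ge0 sqr_ge0.
have j0 : 0 <= 1 + eta ^- 2 by rewrite addr_ge0.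
(* eps times [K] bounds the tail: 2 M bounds |g x - g y|, 1 + eta^-2 comes from [poisson_tail], and
   pi is the mass of [poisson 1]. *)
pose K := 2 * M * (1 + eta ^- 2) * pi.
have K0 : 0 <= K by rewrite !mulr_ge0// ltW.
have : harmonic n @[n --> \oo] --> (0 : R) by exact: cvg_harmonic.
(* The [+ 1] keeps the divisor positive when [K] is 0. *)
have K1 : 0 < e / 2 / (K + 1) by rewrite !divr_gt0// ltr_wpDl.
move=> /cvgr0Pnorm_le /(_ _ K1); apply: filterS => n /=.
set eps := n.+1%:R^-1; have eps0 : 0 < eps by rewrite invr_gt0.
rewrite ger0_norm ?(ltW eps0)// ler_pdivlMr ?ltr_wpDl// => epsK.
have ip : intg (fun y => poisson eps (x - y)) by exact: integrable_poisson.
have ip1 : intg (fun y => poisson 1 (x - y)) by exact: integrable_poisson.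
have igp := integrable_mul_poisson x eps0 ing.
have icp : intg (fun y => g x * poisson eps (x - y)).
  exact: (@integrableZl _ _ _ mu setT measurableT _ (EFin \o (fun y => poisson eps (x - y)))).
have idp : intg (fun y => d * poisson eps (x - y)).
  exact: (@integrableZl _ _ _ mu setT measurableT _ (EFin \o (fun y => poisson eps (x - y)))).
have itp : intg (fun y => 2 * M * eps * (1 + eta ^- 2) * poisson 1 (x - y)).
  exact: (@integrableZl _ _ _ mu setT measurableT _ (EFin \o (fun y => poisson 1 (x - y)))).
have isp : intg (fun y => d * poisson eps (x - y) + 2 * M * eps * (1 + eta ^- 2) * poisson 1 (x - y)).
  have := integrableD measurableT idp itp.
  by apply: eq_integrable => // y _ /=; rewrite EFinD.
have ibp : intg (fun y => g x * poisson eps (x - y) - g y * poisson eps (x - y)).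
  have := integrableB measurableT icp igp.
  by apply: eq_integrable => // y _ /=; rewrite EFinB.
rewrite mulrC -(Rintegral_poisson x eps0) -RintegralZl// -RintegralB//.
apply: (le_trans (le_normr_Rintegral measurableT ibp)).
(* Adding the near and far majorants avoids splitting the integral: on each range one term suffices
   and the other is nonnegative. *)
apply: (@le_trans _ _ (\int[mu]_y (d * poisson eps (x - y) +
    2 * M * eps * (1 + eta ^- 2) * poisson 1 (x - y)))).
  apply: le_Rintegral => //; first exact: (integrable_norm ibp).
  move=> y _; rewrite -mulrBl normrM.
  have P0 := ltW (poisson_gt0 (x - y) eps0).
  have P1 := ltW (poisson_gt0 (x - y) (@ltr01 R)).
  rewrite (ger0_norm P0).
  have t0 : 0 <= eps * (1 + eta ^- 2) by rewrite mulr_ge0// ltW.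
  have [xy|xy] := ltP `|x - y| eta.
    apply: ler_wpDr; last by rewrite ler_wpM2r// geta.
    by rewrite -[2 * M * eps * _]mulrA mulr_ge0// mulr_ge0// mulr_ge0.
  apply: ler_wpDl; first by rewrite mulr_ge0// ltW.
  rewrite -[2 * M * eps * _]mulrA -mulrA; apply: ler_pM => //; last exact: poisson_tail.
  by rewrite (le_trans (ler_normB _ _))// mulr_natl mulr2n lerD.
rewrite RintegralD// RintegralZl// [X in X + _ <= _]RintegralZl// !Rintegral_poisson//.
have -> : d * pi = e / 2 by rewrite /d invfM mulrA mulfVK// gt_eqF.
have -> : 2 * M * eps * (1 + eta ^- 2) * pi = eps * K by rewrite /K; ring.
by nra.
Qed.

(** Dominated convergence with majorant |g| M pi identifies the limit of the damped energies. At a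
    point where g vanishes, the factor g(x) in front of the convolution makes the integrand 0 for
    every n, so a jump there is harmless. *)
Lemma energy_bounded_continuous g (M : R) : intg g -> intg (fun x => g x ^+ 2) ->
  (forall y, `|g y| <= M) -> (forall x, g x = 0 \/ {for x, continuous g}) ->
  energy g = (pi * \int[mu]_x (g x ^+ 2))%:E.
Proof.
move=> ing ing2 gM cg.
have M0 : 0 <= M by exact: le_trans (gM 0).
apply: (cvg_unique _ (cvg_damped_energy ing)) => //.
have mg := integrable_measurable ing.
pose F (n : nat) x := (g x * \int[mu]_y (g y * poisson n.+1%:R^-1 (x - y)))%:E.
have n0 (n : nat) : 0 < (n.+1%:R^-1 : R) by rewrite invr_gt0.
have iF n : mu.-integrable setT (F n).
  apply: (@integrable_kernel R g g (fun z => poisson n.+1%:R^-1 (z.1 - z.2)) (n.+1%:R^-1)^-1) => //.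
    exact: measurable_poisson2.
  by move=> z; exact: poisson_norm_le.
have := @dominated_convergence _ (measurableTypeR R) R mu setT measurableT F
  (fun x => (g x ^+ 2 * pi)%:E) (fun x => `|(g x)%:E| * (M * pi)%:E)%E.
case.
- by move=> n; exact: measurable_int (iF n).
- apply/measurable_EFinP; apply: measurable_funM => //; exact: measurable_funX.
- apply: aeW => x _; apply: cvg_EFin; first exact: nearW.
  rewrite expr2 -mulrA [g x * pi]mulrC.
  have [gx0|cgx] := cg x.
    rewrite gx0 mul0r; rewrite [X in X @ _ --> _](_ : _ = cst 0); first exact: cvg_cst.
    by apply/funext => n; rewrite /F /= gx0 mul0r.
  by apply: cvgM; [exact: cvg_cst|exact: (cvg_poisson_conv ing gM cgx)].
- apply: integrableZr => //; exact: integrable_abse.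
- apply: aeW => x n _; rewrite lee_fin normrM ler_wpM2l//.
  have ip : intg (fun y => poisson n.+1%:R^-1 (x - y)) by exact: integrable_poisson.
  apply: (le_trans (le_normr_Rintegral measurableT (integrable_mul_poisson x (n0 n) ing))).
  rewrite -(Rintegral_poisson x (n0 n)) -RintegralZl//; apply: le_Rintegral => //.
  + exact: (integrable_norm (integrable_mul_poisson x (n0 n) ing)).
  + exact: (@integrableZl _ _ _ mu setT measurableT _ (EFin \o (fun y => poisson n.+1%:R^-1 (x - y)))).
  + move=> y _; have P0 := ltW (poisson_gt0 (x - y) (n0 n)).
    by rewrite normrM (ger0_norm P0) ler_wpM2r.
move=> _ _.
have -> : (\int[mu]_x (g x ^+ 2 * pi)%:E = (pi * \int[mu]_x (g x ^+ 2))%:E)%E.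
  rewrite mulrC -RintegralZr// /Rintegral fineK//; apply: integrable_fin_num => //.
  exact: (integrable_mul_bounded (h := cst pi) (M := `|pi|)).
apply: cvg_trans; apply: near_eq_cvg; apply: nearW => n /=.
rewrite damped_trig_poisson// /Rintegral fineK//.
by apply: integrable_fin_num => //; exact: iF.
Qed.

End ApproximateIdentity.

(** * Weighted squares and truncation of values *)

Section Density.
Context {R : realType}.
Local Notation mu := (@lebesgue_measure R).
Local Notation intg f := (mu.-integrable setT (EFin \o f)).
Implicit Types f g : R -> R.

(** This performs the limit s -> 0 in the weighted triangle inequalities; the restriction s <= 1
    allows higher powers of s to be absorbed into the linear term. *)
Lemma ler_linear_slack (a b K : R) :
  (forall s, 0 < s -> s <= 1 -> a <= b + s * K) -> a <= b.
Proof.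
move=> H; apply/ler_addgt0Pr => e e0.
pose s := Num.min 1 (e / (`|K| + 1)).
have k0 : 0 < `|K| + 1 by rewrite ltr_wpDl.
have s0 : 0 < s by rewrite lt_min ltr01 divr_gt0.
apply: (le_trans (H s s0 _)); first by rewrite ge_min lexx.
rewrite lerD2l (le_trans (ler_norm _))// normrM (gtr0_norm s0).
apply: (@le_trans _ _ (e / (`|K| + 1) * `|K|)).
  by rewrite ler_wpM2r// ge_min lexx orbT.
by rewrite mulrAC ler_pdivrMr// ler_wpM2l ?(ltW e0)// lerDl.
Qed.

(** The difference of the two sides is s (a - b/s)^2. The main term keeps a factor close to 1 at the
    price of a large factor on the error. *)
Lemma sqrD_le (s a b : R) : 0 < s -> (a + b) ^+ 2 <= (1 + s) * a ^+ 2 + (1 + s^-1) * b ^+ 2.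
Proof.
move=> s0; rewrite -subr_ge0.
have -> : (1 + s) * a ^+ 2 + (1 + s^-1) * b ^+ 2 - (a + b) ^+ 2 = s * (a - s^-1 * b) ^+ 2.
  by field; rewrite gt_eqF.
by rewrite mulr_ge0 ?sqr_ge0// ltW.
Qed.

(* The truncation of x to [-M, M], in a form whose Lipschitz bounds all follow
   from the reverse triangle inequality. *)
Definition clip (M x : R) : R := (`|x + M| - `|x - M|) / 2.

Lemma clip_lipschitz M x y : `|clip M x - clip M y| <= `|x - y|.
Proof.
have -> : clip M x - clip M y = ((`|x + M| - `|y + M|) + (`|y - M| - `|x - M|)) / 2.
  by rewrite /clip; field.
rewrite normrM (@ger0_norm _ 2^-1)// ler_pdivrMr// mulr_natr mulr2n.
apply: (le_trans (ler_normD _ _)); apply: lerD.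
  by apply: (le_trans (ler_dist_dist _ _)); rewrite opprD addrACA subrr addr0.
by apply: (le_trans (ler_dist_dist _ _)); rewrite distrC opprB addrA subrK.
Qed.

Lemma clip0 M : clip M 0 = 0.
Proof. by rewrite /clip add0r sub0r normrN subrr mul0r. Qed.

Lemma clip_le_norm M x : `|clip M x| <= `|x|.
Proof. by have := clip_lipschitz M x 0; rewrite clip0 !subr0. Qed.

Lemma clip_le M x : 0 <= M -> `|clip M x| <= M.
Proof.
move=> M0; rewrite /clip normrM (@ger0_norm _ 2^-1)// ler_pdivrMr//.
apply: (le_trans (ler_dist_dist _ _)).
have -> : x + M - (x - M) = M * 2 by ring.
by rewrite ger0_norm// mulr_ge0.
Qed.

Lemma clip_id M x : `|x| <= M -> clip M x = x.
Proof.
rewrite ler_norml => /andP[h1 h2]; rewrite /clip ger0_norm; last by lra.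
by rewrite ler0_norm; [field|lra].
Qed.

Lemma continuous_clip M : continuous (clip M).
Proof.
move=> x; apply/cvgrPdist_le => e e0; near=> y.
apply: (le_trans (clip_lipschitz _ _ _)); near: y.
by move/cvgrPdist_le : (@cvg_id _ (nbhs x)); exact.
Unshelve. all: by end_near. Qed.

Lemma measurable_clip M : measurable_fun setT (clip M).
Proof. by apply: continuous_measurable_fun; exact: continuous_clip. Qed.

Lemma integrable_le f g : measurable_fun setT f -> (forall x, `|f x| <= `|g x|) ->
  intg g -> intg f.
Proof.
move=> mf fg ing; apply: (le_integrable measurableT _ _ ing); first exact/measurable_EFinP.
by move=> x _; rewrite lee_fin.
Qed.

Lemma integrable_clip f M : intg f -> intg (clip M \o f).
Proof.
move=> intf; apply: (integrable_le _ _ intf).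
  by apply: measurableT_comp; [exact: measurable_clip|exact: integrable_measurable].
by move=> x; exact: clip_le_norm.
Qed.

Lemma integrable_sqr_clip f M : intg f -> intg (fun x => f x ^+ 2) ->
  intg (fun x => (f x - clip M (f x)) ^+ 2).
Proof.
move=> intf intf2; have mf := integrable_measurable intf.
(* |f - clip f| <= 2 |f|, whence the factor 4. *)
have int4 : intg (fun x => 4 * f x ^+ 2).
  exact: (@integrableZl _ _ _ mu setT measurableT _ (EFin \o (fun x => f x ^+ 2))).
apply: (integrable_le _ _ int4).
  apply: measurable_funX; apply: measurable_funB => //.
  by apply: measurableT_comp => //; exact: measurable_clip.
move=> x; rewrite (normrM 4) (@ger0_norm _ 4)// !normrX.
have := ler_normB (f x) (clip M (f x)); have := clip_le_norm M (f x).
have := normr_ge0 (f x - clip M (f x)); set a := `|f x|; set b := `|clip _ _|; set c := `|_ - _|.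
nra.
Qed.

(** Dominated convergence: for fixed x the error is 0 as soon as n >= |f x|, and 4 f^2 is an
    integrable majorant. *)
Lemma clip_approx f (e : R) : intg f -> intg (fun x => f x ^+ 2) -> 0 < e ->
  exists2 M, 0 <= M & \int[mu]_x ((f x - clip M (f x)) ^+ 2) <= e.
Proof.
move=> intf intf2 e0; have mf := integrable_measurable intf.
have int4 : intg (fun x => 4 * f x ^+ 2).
  exact: (@integrableZl _ _ _ mu setT measurableT _ (EFin \o (fun x => f x ^+ 2))).
have := @dominated_convergence _ (measurableTypeR R) R mu setT measurableT
  (fun n x => ((f x - clip n%:R (f x)) ^+ 2)%:E) (cst 0%E) (EFin \o (fun x => 4 * f x ^+ 2)).
case => //.
- by move=> n; exact: measurable_int (integrable_sqr_clip n%:R intf intf2).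
- apply: aeW => x _; apply: cvg_near_cst; near=> n.
  rewrite clip_id ?subrr ?expr0n//; near: n; exact: nbhs_infty_ger.
- apply: aeW => x n _; rewrite lee_fin.
  rewrite normrX.
  have := ler_normB (f x) (clip n%:R (f x)); have := clip_le_norm n%:R (f x).
  rewrite -[f x ^+ 2]real_normK ?num_real//.
  have := normr_ge0 (f x - clip n%:R (f x)); set a := `|f x|; set b := `|clip _ _|; set c := `|_ - _|.
  by nra.
move=> _ _; rewrite integral0 => /fine_cvg /cvgr0Pnorm_le /(_ e e0) [N _ /(_ N (leqnn N))] /= H.
by exists N%:R => //; apply: le_trans H; exact: ler_norm.
Unshelve. all: by end_near. Qed.

End Density.

(** * Density of test functions and the energy identity *)

Section EnergyIdentity.
Context {R : realType}.
Local Notation mu := (@lebesgue_measure R).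
Local Notation intg f := (mu.-integrable setT (EFin \o f)).
Implicit Types f g : R -> R.

Lemma integrable_restrictT f (D : set R) : measurable D ->
  mu.-integrable D (EFin \o f) -> intg (f \_ D).
Proof. by move=> mD /integrable_mkcond => /(_ mD); rewrite -restrict_EFin. Qed.

Lemma integrable_sqrB f g : intg f -> intg g ->
  intg (fun x => f x ^+ 2) -> intg (fun x => g x ^+ 2) -> intg (fun x => (f x - g x) ^+ 2).
Proof.
move=> intf ing intf2 ing2.
have i1 : intg (fun x => 2 * f x ^+ 2 + 2 * g x ^+ 2).
  have := integrableD measurableT (integrableZl measurableT 2 intf2) (integrableZl measurableT 2 ing2).
  by apply: eq_integrable => // x _ /=; rewrite -!EFinM -EFinD.
apply: (integrable_le _ _ i1).
  apply: measurable_funX; apply: measurable_funB; exact: integrable_measurable.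
move=> x; rewrite ger0_norm ?sqr_ge0// (le_trans _ (ler_norm _))//.
(* Parallelogram law: 2 f^2 + 2 g^2 - (f - g)^2 = (f + g)^2. *)
by have := sqr_ge0 (f x + g x); nra.
Qed.

Lemma Rintegral_sqrD_le (s : R) f g h : 0 < s -> (forall x, f x = g x + h x) ->
  intg (fun x => f x ^+ 2) -> intg (fun x => g x ^+ 2) -> intg (fun x => h x ^+ 2) ->
  \int[mu]_x (f x ^+ 2) <=
    (1 + s) * \int[mu]_x (g x ^+ 2) + (1 + s^-1) * \int[mu]_x (h x ^+ 2).
Proof.
move=> s0 fgh f2 g2 h2.
have ig := integrableZl measurableT (1 + s) g2.
have ih := integrableZl measurableT (1 + s^-1) h2.
rewrite -RintegralZl// -RintegralZl// -RintegralD//.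
apply: le_Rintegral => //; first by have := integrableD measurableT ig ih.
by move=> x _; rewrite fgh sqrD_le.
Qed.

(** Continuous functions approximate f in L^1 of the interval; the common bound M upgrades this to
    L^2 through (f - g)^2 <= 2 M |f - g|. Clipping the approximant does not increase its distance to
    f, because f is fixed by the clip, which is 1-Lipschitz. *)
Lemma continuous_approx f (M r e : R) : 0 <= M -> intg f -> (forall x, `|f x| <= M) ->
  (forall x, ~ `]- r, r[%classic x -> f x = 0) -> 0 < e ->
  exists g, [/\ intg g, forall x, `|g x| <= M,
    forall x, g x = 0 \/ {for x, continuous g} &
    \int[mu]_x ((f x - g x) ^+ 2) <= e].
Proof.
move=> M0 intf fM f0 e0.
set E : set R := `]- r, r[%classic in f0.
have mE : measurable (E : set (measurableTypeR R)) by exact: measurable_itv.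
have Efin : (mu E < +oo)%E.
  by rewrite /E lebesgue_measure_itv/=; case: ifP => // _; rewrite -EFinD ltry.
have intfE : mu.-integrable E (EFin \o f) by exact: integrableS intf.
have [h [ch ih /fine_cvg]] := approximation_continuous_integrable mE Efin intfE.
(* 2 M times this tolerance is at most e; the [+ 1] covers M = 0. *)
have K0 : 0 < e / (2 * M + 1) by rewrite divr_gt0// ltr_wpDl// mulr_ge0.
move=> /cvgr0Pnorm_le /(_ _ K0) [N _ /(_ N (leqnn N))] /=.
move: (h N) (ch N) (ih N) => {ch ih}h ch ih hN.
have {}hN : \int[mu]_(x in E) `|f x - h x| <= e / (2 * M + 1) by exact: le_trans (ler_norm _) hN.
(* The clip provides the bound M and the cut matches the support of [f]. The interval is open, so
   [g] agrees with a continuous function near each of its points. *)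
pose g := (clip M \o h) \_ E.
have mh := continuous_measurable_fun ch.
have mg : measurable_fun setT g.
  apply/(measurable_restrictT _ mE); apply: measurable_funTS.
  by apply: measurableT_comp => //; exact: measurable_clip.
have gM x : `|g x| <= M.
  by rewrite /g patchE; case: ifP => _; [exact: clip_le|rewrite normr0].
have ing : intg g.
  apply: (integrable_le mg _ (integrable_restrictT mE ih)) => x.
  by rewrite /g !patchE; case: ifP => // _; exact: clip_le_norm.
exists g; split => //.
  move=> x; have [xE|xE] := pselect (E x); last first.
    by left; rewrite /g patchE memNset.
  right; have cc : {for x, continuous (clip M \o h)}.
    by apply: continuous_comp; [exact: ch|exact: continuous_clip].
  rewrite /prop_for /continuous_at {2}/g patchE mem_set//.
  apply: cvg_trans cc; apply: near_eq_cvg.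
  have oE : open E by exact: interval_open.
  have := open_nbhs_nbhs (conj oE xE); apply: filterS => y yE.
  by rewrite /g patchE mem_set.
have intfh : mu.-integrable E (EFin \o (fun x => `|f x - h x|)).
  have ifh : mu.-integrable E (EFin \o (fun x => f x - h x)).
    by have := integrableB mE intfE ih; apply: eq_integrable => // x _ /=; rewrite EFinB.
  exact: (integrable_norm ifh).
have ifh : intg (fun x => ((fun x => `|f x - h x|) \_ E) x * (2 * M)).
  apply: (integrable_mul_bounded (h := cst (2 * M)) (M := `|2 * M|)) => //.
  exact: integrable_restrictT.
have D1 x : (f x - g x) ^+ 2 <= ((fun x => `|f x - h x|) \_ E) x * (2 * M).
  have [xE|xE] := pselect (E x); last first.
    by rewrite /g !patchE memNset// f0// subrr expr0n mul0r.
  rewrite patchE mem_set// -real_normK ?num_real// expr2 ler_pM//.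
    by rewrite /g patchE mem_set//= -{1}(clip_id (fM x)) clip_lipschitz.
  by rewrite (le_trans (ler_normB _ _))// mulr_natl mulr2n lerD.
apply: (@le_trans _ _ (\int[mu]_x (((fun x => `|f x - h x|) \_ E) x * (2 * M)))).
  apply: le_Rintegral => //.
  apply: (integrable_le _ _ ifh).
    by apply: measurable_funX; apply: measurable_funB => //; exact: integrable_measurable.
  by move=> x; rewrite ger0_norm ?sqr_ge0// (le_trans (D1 x))// ler_norm.
rewrite RintegralZr//; last exact: integrable_restrictT.
rewrite -Rintegral_mkcond; apply: (le_trans (ler_wpM2r _ hN)); first by rewrite mulr_ge0.
by rewrite mulrAC ler_pdivrMr ?ltr_wpDl ?mulr_ge0// ler_wpM2l ?(ltW e0)// lerDl.
Qed.

(** Clipping precedes the continuous approximation because the passage from L^1 to L^2 needs a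
    bounded function. *)
Lemma test_function_approx f (r e : R) : intg f -> intg (fun x => f x ^+ 2) ->
  (forall x, ~ `]- r, r[%classic x -> f x = 0) -> 0 < e ->
  exists g M, [/\ intg g, intg (fun x => g x ^+ 2), forall x, `|g x| <= M,
    forall x, g x = 0 \/ {for x, continuous g} &
    \int[mu]_x ((f x - g x) ^+ 2) <= e].
Proof.
move=> intf intf2 f0 e0.
(* The two errors are added with s = 1, which doubles each: 2 e/4 + 2 e/4 = e. *)
have e4 : 0 < e / 4 by rewrite divr_gt0.
have [M M0 fM] := clip_approx intf intf2 e4.
have ic := integrable_clip M intf.
have cM x : `|clip M (f x)| <= M by exact: clip_le.
have cf0 x : ~ `]- r, r[%classic x -> (clip M \o f) x = 0 by move=> /f0 /= ->; rewrite clip0.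
have [g [ing gM cg fg]] := continuous_approx M0 ic cM cf0 e4.
have ic2 : intg (fun x => clip M (f x) ^+ 2).
  exact: (integrable_mul_bounded ic (integrable_measurable ic) cM).
have ing2 : intg (fun x => g x ^+ 2).
  exact: (integrable_mul_bounded ing (integrable_measurable ing) gM).
exists g, M; split => //.
have dE x : f x - g x = (f x - clip M (f x)) + (clip M (f x) - g x) by rewrite addrA subrK.
have := Rintegral_sqrD_le ltr01 dE (integrable_sqrB intf ing intf2 ing2)
  (integrable_sqr_clip M intf intf2) (integrable_sqrB ic ing ic2 ing2).
rewrite invr1 => H; apply: (le_trans H).
by move: fM fg => /=; lra.
Qed.

Lemma trig_integralB (phi : R -> R) f g (xi : R) : continuous phi -> (forall x, `|phi x| <= 1) ->
  intg f -> intg g ->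
  trig_integral phi (fun x => f x - g x) xi = trig_integral phi f xi - trig_integral phi g xi.
Proof.
move=> cphi phi1 intf ing; rewrite /trig_integral -RintegralB//; [|exact: integrable_trig..].
by apply: eq_Rintegral => x _; rewrite mulrBl.
Qed.

(** The transforms are linear in the function, so [sqrD_le] applies pointwise to the cosine and the
    sine part. *)
Lemma energy_triangle f g (s : R) : 0 < s -> intg f -> intg g ->
  (energy g <= (1 + s)%:E * energy f + (1 + s^-1)%:E * energy (fun x => f x - g x)%R)%E.
Proof.
move=> s0 intf ing.
have intfg : intg (fun x => f x - g x).
  by have := integrableB measurableT intf ing; apply: eq_integrable => // x _ /=; rewrite EFinB.
have m (h : R -> R) : intg h ->
  measurable_fun `[(0 : R), +oo[ (fun xi => (trig_integral cos h xi ^+ 2 + trig_integral sin h xi ^+ 2)%:E).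
  by move=> inth; apply/measurable_EFinP; apply: measurable_funTS; exact: measurable_energy_density.
have s1 : 0 <= 1 + s by rewrite addr_ge0// ltW.
have s2 : 0 <= 1 + s^-1 by rewrite addr_ge0// invr_ge0 ltW.
rewrite /energy -!ge0_integralZl//; first last.
- by move=> x _; rewrite lee_fin energy_density_ge0.
- exact: m.
- by move=> x _; rewrite lee_fin energy_density_ge0.
- exact: m.
rewrite -ge0_integralD//; first last.
- by apply: measurable_funeM; exact: m.
- by move=> x _; rewrite -EFinM lee_fin mulr_ge0 ?energy_density_ge0.
- by apply: measurable_funeM; exact: m.
- by move=> x _; rewrite -EFinM lee_fin mulr_ge0 ?energy_density_ge0.
apply: ge0_le_integral => //.
- by move=> x _; rewrite lee_fin energy_density_ge0.
- exact: m.
- by apply: emeasurable_funD; apply: measurable_funeM; exact: m.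
move=> xi _; rewrite -!EFinM -EFinD lee_fin.
rewrite (trig_integralB xi (@continuous_cos R) cos_norm_le1)//.
rewrite (trig_integralB xi (@continuous_sin R) sin_norm_le1)//.
set a := trig_integral cos f xi; set b := trig_integral cos g xi.
set c := trig_integral sin f xi; set d := trig_integral sin g xi.
have := sqrD_le a (b - a) s0; have := sqrD_le c (d - c) s0.
rewrite -[(b - a) ^+ 2]sqrrN -[(d - c) ^+ 2]sqrrN !opprB ![_ + (_ - _)]addrC !subrK.
by rewrite !mulrDr; lra.
Qed.

Lemma energy_ge0 f : (0 <= energy f)%E.
Proof. by apply: integral_ge0 => x _; rewrite lee_fin energy_density_ge0. Qed.

(** Only the lower bound remains. The identity for a test function g is carried over to f by two
    weighted triangle inequalities, one for the squared norms and one for the energies; [energy_le]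
    controls the energy of f - g. *)
Lemma energyE f (r : R) : intg f -> intg (fun x => f x ^+ 2) ->
  (forall x, ~ `]- r, r[%classic x -> f x = 0) ->
  energy f = (pi * \int[mu]_x (f x ^+ 2))%:E.
Proof.
move=> intf intf2 f0; apply/eqP; rewrite eq_le energy_le//=.
have fin : energy f \is a fin_num.
  by rewrite ge0_fin_numE ?energy_ge0// (le_lt_trans (energy_le intf intf2))// ltry.
rewrite -(fineK fin) lee_fin.
have E0 : 0 <= fine (energy f) by exact/fine_ge0/energy_ge0.
set E := fine (energy f) in E0 *; set I := \int[mu]_x _.
have pi0 := pi_gt0 R.
(* The estimates give (1 + s)^2 E + 2 pi s^2 (1 + s) + 2 pi s^2; for s <= 1 the excess over E is at
   most s (3 E + 6 pi). *)
apply: (@ler_linear_slack R _ _ (3 * E + 6 * pi)) => s s0 s1.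
(* With error s^3 the weighted error (1 + 1/s) s^3 = s^3 + s^2 still vanishes with s. *)
have s30 : 0 < s ^+ 3 by exact: exprn_gt0.
have [g [M [ing ing2 gM cg fg]]] := test_function_approx intf intf2 f0 s30.
have ifg2 := integrable_sqrB intf ing intf2 ing2.
have ifg : intg (fun x => f x - g x).
  by have := integrableB measurableT intf ing; apply: eq_integrable => // x _ /=; rewrite EFinB.
have : I <= (1 + s) * \int[mu]_x (g x ^+ 2) + (1 + s^-1) * \int[mu]_x ((f x - g x) ^+ 2).
  by apply: Rintegral_sqrD_le => // x; rewrite addrC subrK.
have : (energy g <= ((1 + s) * E + (1 + s^-1) * (pi * \int[mu]_x ((f x - g x) ^+ 2)))%:E)%E.
  apply: (le_trans (energy_triangle s0 intf ing)).
  rewrite [leRHS]EFinD (EFinM (1 + s)) (EFinM (1 + s^-1)) /E fineK// leeD2l// lee_wpmul2l//; last exact: energy_le.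
  by rewrite lee_fin addr_ge0// invr_ge0 ltW.
rewrite (energy_bounded_continuous ing ing2 gM cg) lee_fin.
set J := \int[mu]_x (g x ^+ 2); set K := \int[mu]_x ((f x - g x) ^+ 2) in fg *.
have K0 : 0 <= K by apply: Rintegral_ge0 => x _; exact: sqr_ge0.
have sK : (1 + s^-1) * K <= 2 * s ^+ 2.
  apply: (@le_trans _ _ ((1 + s^-1) * s ^+ 3)).
    by rewrite ler_wpM2l// addr_ge0// invr_ge0 ltW.
  have -> : (1 + s^-1) * s ^+ 3 = s ^+ 3 + s ^+ 2 by field; rewrite gt_eqF.
  have : s ^+ 3 <= s ^+ 2 by rewrite exprSr ler_piMr ?sqr_ge0.
  by lra.
have -> : (1 + s^-1) * (pi * K) = pi * ((1 + s^-1) * K) by ring.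
move: sK; set L := (1 + s^-1) * K => sK H1 H2.
have H3 : pi * L <= pi * (2 * s ^+ 2) by rewrite ler_wpM2l// ltW.
have H4 : pi * I <= (1 + s) * (pi * J) + pi * L.
  by have := ler_wpM2l (ltW pi0) H2; lra.
have H5 : (1 + s) * (pi * J) <= (1 + s) * ((1 + s) * E + pi * (2 * s ^+ 2)).
  by rewrite ler_wpM2l ?addr_ge0 ?(ltW s0)//; lra.
have s2 : s ^+ 2 <= s by rewrite expr2 ler_piMr// ltW.
have H6 : s ^+ 2 * E <= s * E by rewrite ler_wpM2r.
have H7 : s ^+ 2 * pi <= s * pi by rewrite ler_wpM2r// ltW.
have H8 : s ^+ 2 * s * pi <= s * pi.
  by rewrite ler_wpM2r ?(ltW pi0)// (le_trans _ s2)// ler_piMr// sqr_ge0.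
nra.
Qed.

End EnergyIdentity.

(** * Squared L^2 norms of complex functions and their limits *)

Section Plancherel.
Context {R : realType}.
Local Notation mu := (@lebesgue_measure R).
Implicit Types f g h : cfun R.

(** This is the part of [cL2] that the squared triangle inequality needs; truncated transforms enter
    that inequality with no finiteness established. *)
Definition cmeasurable f : Prop :=
  measurable_fun setT (fun x => (f x).1) /\ measurable_fun setT (fun x => (f x).2).

Lemma cL2_cmeasurable f : cL2 f -> cmeasurable f.
Proof. by case=> ? []. Qed.

Lemma csq_ge0 (z : R * R) : 0 <= csq z.
Proof. by rewrite addr_ge0// sqr_ge0. Qed.

Lemma L2norm2_ge0 f : (0 <= L2norm2 f)%E.
Proof. by apply: integral_ge0 => x _; rewrite lee_fin csq_ge0. Qed.

Lemma measurable_csq f : cmeasurable f -> measurable_fun setT (fun x => csq (f x)).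
Proof. by case=> m1 m2; apply: measurable_funD; apply: measurable_funX. Qed.

Lemma cmeasurableB f g : cmeasurable f -> cmeasurable g -> cmeasurable (csub f g).
Proof. by move=> [f1 f2] [g1 g2]; split; apply: measurable_funB. Qed.

Lemma L2norm2_csubC f g : L2norm2 (csub f g) = L2norm2 (csub g f).
Proof.
apply: eq_integral => x _; congr EFin; rewrite /csq/=.
by rewrite -[(_ - (g x).1) ^+ 2]sqrrN -[(_ - (g x).2) ^+ 2]sqrrN !opprB.
Qed.

Lemma L2norm2_triangle (s : R) f g : 0 < s -> cmeasurable f -> cmeasurable g ->
  (L2norm2 f <= (1 + s)%:E * L2norm2 g + (1 + s^-1)%:E * L2norm2 (csub f g))%E.
Proof.
move=> s0 mf mg; have mfg := cmeasurableB mf mg.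
have s1 : 0 <= 1 + s by rewrite addr_ge0// ltW.
have s2 : 0 <= 1 + s^-1 by rewrite addr_ge0// invr_ge0 ltW.
have m h : cmeasurable h -> measurable_fun setT (fun x => (csq (h x))%:E).
  by move=> mh; apply/measurable_EFinP; exact: measurable_csq.
rewrite /L2norm2 -!ge0_integralZl//; first last.
- by move=> x _; rewrite lee_fin csq_ge0.
- exact: m.
- by move=> x _; rewrite lee_fin csq_ge0.
- exact: m.
rewrite -ge0_integralD//; first last.
- by apply: measurable_funeM; exact: m.
- by move=> x _; rewrite -EFinM lee_fin mulr_ge0 ?csq_ge0.
- by apply: measurable_funeM; exact: m.
- by move=> x _; rewrite -EFinM lee_fin mulr_ge0 ?csq_ge0.
apply: ge0_le_integral => //.
- by move=> x _; rewrite lee_fin csq_ge0.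
- exact: m.
- by apply: emeasurable_funD; apply: measurable_funeM; exact: m.
move=> x _; rewrite -!EFinM -EFinD lee_fin /csq/= !mulrDr.
have := sqrD_le (g x).1 ((f x).1 - (g x).1) s0.
have := sqrD_le (g x).2 ((f x).2 - (g x).2) s0.
by rewrite ![_ + (_ - _)]addrC !subrK; lra.
Qed.

(** For fixed s the weighted triangle inequality between F n and g is passed to the limit in both
    directions, the error term vanishing; then s tends to 0. Finiteness of both sides allows this
    last step to take place in the reals. *)
Lemma L2norm2_limit (F : nat -> cfun R) g (a : \bar R) :
  (forall n, cmeasurable (F n)) -> cmeasurable g ->
  (L2norm2 g < +oo)%E -> (a < +oo)%E ->
  L2norm2 (F n) @[n --> \oo] --> a ->
  L2norm2 (csub (F n) g) @[n --> \oo] --> 0%E -> L2norm2 g = a.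
Proof.
move=> mF mg goo aoo Fa Fg.
have a0 : (0 <= a)%E by apply: (cvge_to_ge Fa); apply: nearW => n; exact: L2norm2_ge0.
have fa : a \is a fin_num by rewrite ge0_fin_numE.
have fg : L2norm2 g \is a fin_num by rewrite ge0_fin_numE// L2norm2_ge0.
have Z (s : R) (v : nat -> \bar R) (l : \bar R) : l \is a fin_num ->
    (v n @[n --> \oo] --> l ->
     (1 + s)%:E * v n + (1 + s^-1)%:E * L2norm2 (csub (F n) g) @[n --> \oo] --> (1 + s)%:E * l)%E.
  move=> lf vl; rewrite -[X in _ --> X]adde0 -(mule0 (1 + s^-1)%:E); apply: cvgeD.
  - by rewrite mule0 fin_num_adde_defl.
  - by apply: cvgeZl.
  - by apply: cvgeZl.
rewrite -(fineK fa) -(fineK fg); congr EFin; apply/eqP; rewrite eq_le.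
apply/andP; split; apply: (@ler_linear_slack R _ _ _) => s s0 s1.
- suff : (L2norm2 g <= (1 + s)%:E * a)%E.
    by rewrite -{1}(fineK fg) -{1}(fineK fa) -EFinM lee_fin mulrDl mul1r; apply.
  apply: (cvge_to_ge (Z s _ _ fa Fa)); apply: nearW => n.
  by rewrite L2norm2_csubC; exact: L2norm2_triangle.
- suff : (a <= (1 + s)%:E * L2norm2 g)%E.
    by rewrite -{1}(fineK fg) -{1}(fineK fa) -EFinM lee_fin mulrDl mul1r; apply.
  (* In the reverse direction the main term is the constant sequence. *)
  have Zg := Z s (fun=> L2norm2 g) _ fg (cvg_cst _).
  by apply: (lee_cvg_to Fa (Zg _)); apply: nearW => n; exact: L2norm2_triangle.
Qed.

End Plancherel.

(** * Truncated Fourier transforms in terms of real transforms *)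

Section FourierPlancherel.
Context {R : realType}.
Local Notation mu := (@lebesgue_measure R).
Local Notation intg f := (mu.-integrable setT (EFin \o f)).
Local Notation C := (trig_integral cos).
Local Notation S := (trig_integral sin).
Implicit Types (f g h : cfun R) (u : R -> R).

(** The interval is open, as the support condition of [energyE] requires, whereas [FT_trunc]
    integrates over the closed one; the endpoints form a null set. *)
Definition window u (n : nat) : R -> R := u \_ `]- (n%:R : R), n%:R[.

Lemma window_out u n x : ~ `]- (n%:R : R), n%:R[%classic x -> window u n x = 0.
Proof. by move=> nx; rewrite /window patchE memNset. Qed.

Lemma cL2_integrable_csq f : cL2 f -> intg (fun x => csq (f x)).
Proof.
move=> cf; apply/integrableP; split.
  by apply/measurable_EFinP; apply: measurable_csq; exact: cL2_cmeasurable.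
under eq_integral do rewrite /= ger0_norm ?csq_ge0//.
by case: cf => _ [].
Qed.

Lemma cL2_integrable_sqr1 f : cL2 f -> intg (fun x => (f x).1 ^+ 2).
Proof.
move=> cf; apply: (integrable_le _ _ (cL2_integrable_csq cf)).
  by apply: measurable_funX; case: cf.
by move=> x; rewrite !ger0_norm ?csq_ge0 ?sqr_ge0// lerDl sqr_ge0.
Qed.

Lemma cL2_integrable_sqr2 f : cL2 f -> intg (fun x => (f x).2 ^+ 2).
Proof.
move=> cf; apply: (integrable_le _ _ (cL2_integrable_csq cf)).
  by apply: measurable_funX; case: cf => _ [].
by move=> x; rewrite !ger0_norm ?csq_ge0 ?sqr_ge0// lerDr sqr_ge0.
Qed.

Lemma measurable_window u n : measurable_fun setT u -> measurable_fun setT (window u n).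
Proof.
move=> mu_; apply/(measurable_restrictT _ (measurable_itv _)).
exact: measurable_funTS.
Qed.

Lemma integrable_window_sqr u n : measurable_fun setT u -> intg (fun x => u x ^+ 2) ->
  intg (fun x => window u n x ^+ 2).
Proof.
move=> mu_ iu2; apply: (integrable_le _ _ iu2).
  by apply: measurable_funX; exact: measurable_window.
by move=> x; rewrite /window patchE; case: ifP => // _; rewrite expr0n normr0.
Qed.

(** On a bounded interval L^2 embeds in L^1, here through |u| <= 1 + u^2. *)
Lemma integrable_window u n : measurable_fun setT u -> intg (fun x => u x ^+ 2) ->
  intg (window u n).
Proof.
move=> mu_ iu2.
(* The flags [false true] select the interval open at both ends. *)
have i1 := @integrable_indic_itv R (- n%:R) n%:R false true.
have i2 : intg (fun x => \1_(`]- (n%:R : R), n%:R[) x + window u n x ^+ 2).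
  exact: (integrableD measurableT i1 (integrable_window_sqr n mu_ iu2)).
apply: (integrable_le _ _ i2); first exact: measurable_window.
move=> x; rewrite /window !patchE indicE; case: ifP => _; last by rewrite normr0.
rewrite [leRHS]ger0_norm ?addr_ge0 ?sqr_ge0// -[u x ^+ 2]real_normK ?num_real//=.
by have := sqr_ge0 (`|u x| - 1); have := normr_ge0 (u x); nra.
Qed.

Lemma trig_integral_window (phi : R -> R) u n (xi : R) :
  continuous phi -> (forall x, `|phi x| <= 1) -> measurable_fun setT u ->
  trig_integral phi (window u n) xi =
  \int[mu]_(x in `[- n%:R, n%:R]) (u x * phi (xi * x)).
Proof.
move=> cphi phi1 mu_.
have E1 : (fun x => window u n x * phi (xi * x)) =
    (fun x => u x * phi (xi * x)) \_ `]- (n%:R : R), n%:R[.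
  by apply/funext => x; rewrite /window !patchE; case: ifP => // _; rewrite mul0r.
have mup : measurable_fun setT (fun x => (u x * phi (xi * x))%:E).
  apply/measurable_EFinP; apply: measurable_funM => //.
  by apply: continuous_measurable_fun; exact: continuous_scaled.
rewrite /trig_integral E1 -Rintegral_mkcond /Rintegral integral_itv_bndo_bndc.
  by rewrite integral_itv_obnd_cbnd//; exact: measurable_funTS.
exact: measurable_funTS.
Qed.

Lemma integrable_itv_trig (phi : R -> R) u n (xi : R) :
  continuous phi -> (forall x, `|phi x| <= 1) -> measurable_fun setT u ->
  intg (fun x => u x ^+ 2) ->
  mu.-integrable `[- (n%:R : R), n%:R] (EFin \o (fun x => u x * phi (xi * x))).
Proof.
move=> cphi phi1 mu_ iu2.
(* The window is taken one larger so that the open interval contains the closed one. *)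
have iw := integrable_trig cphi phi1 xi (integrable_window n.+1 mu_ iu2).
have : mu.-integrable `[- (n%:R : R), n%:R] (EFin \o (fun x => window u n.+1 x * phi (xi * x))).
  exact: integrableS iw.
apply: eq_integrable => // x; rewrite inE/= in_itv/= => /andP[x1 x2].
rewrite /window patchE mem_set//= in_itv/=.
have nS : (n%:R : R) < n.+1%:R by rewrite ltr_nat.
by rewrite (le_lt_trans x2 nS) andbT (lt_le_trans _ x1)// ltrN2.
Qed.

Let sqrt2piV : R := (Num.sqrt (2 * pi))^-1.

Lemma FT_truncE f n xi : cL2 f ->
  FT_trunc f n xi =
  (sqrt2piV * (C (window (fun x => (f x).1) n) xi + S (window (fun x => (f x).2) n) xi),
   sqrt2piV * (C (window (fun x => (f x).2) n) xi - S (window (fun x => (f x).1) n) xi)).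
Proof.
move=> cf; have [m1 m2] := cL2_cmeasurable cf.
have cc := @continuous_cos R; have c1 := @cos_norm_le1 R.
have cs := @continuous_sin R; have s1 := @sin_norm_le1 R.
have i1 := cL2_integrable_sqr1 cf; have i2 := cL2_integrable_sqr2 cf.
rewrite /FT_trunc; congr (_ * _, _ * _).
  rewrite RintegralD ?trig_integral_window//; exact: integrable_itv_trig.
rewrite RintegralB ?trig_integral_window//; exact: integrable_itv_trig.
Qed.

Lemma trig_integral_cosN u xi : C u (- xi) = C u xi.
Proof. by apply: eq_Rintegral => x _; rewrite mulNr cosN. Qed.

Lemma trig_integral_sinN u xi : intg u -> S u (- xi) = - S u xi.
Proof.
move=> iu; rewrite -[RHS]mulN1r /trig_integral -RintegralZl//; last first.
  exact: (integrable_trig (@continuous_sin R) (@sin_norm_le1 R)).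
by apply: eq_Rintegral => x _; rewrite mulNr sinN mulrN mulN1r.
Qed.

Lemma continuous_FT f n : cL2 f ->
  continuous (fun xi => (FT_trunc f n xi).1) /\ continuous (fun xi => (FT_trunc f n xi).2).
Proof.
move=> cf; have [m1 m2] := cL2_cmeasurable cf.
have i1 := integrable_window n m1 (cL2_integrable_sqr1 cf).
have i2 := integrable_window n m2 (cL2_integrable_sqr2 cf).
have cC u : intg u -> continuous (C u).
  exact: (continuous_trig_integral (@continuous_cos R) (@cos_norm_le1 R)).
have cS u : intg u -> continuous (S u).
  exact: (continuous_trig_integral (@continuous_sin R) (@sin_norm_le1 R)).
split.
  rewrite (_ : (fun xi => _) = (fun xi => sqrt2piV *
    (C (window (fun x => (f x).1) n) xi + S (window (fun x => (f x).2) n) xi))).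
    by apply: continuous_mulf; [move=> ?; exact: cvg_cst|apply: continuous_addf; auto].
  by apply/funext => xi; rewrite FT_truncE.
rewrite (_ : (fun xi => _) = (fun xi => sqrt2piV *
  (C (window (fun x => (f x).2) n) xi + - S (window (fun x => (f x).1) n) xi))).
  apply: continuous_mulf; first by move=> ?; exact: cvg_cst.
  by apply: continuous_addf; [auto|move=> xi; apply: cvgN; exact: cS].
by apply/funext => xi; rewrite FT_truncE.
Qed.

Lemma cmeasurable_FT_trunc f n : cL2 f -> cmeasurable (FT_trunc f n).
Proof.
by move=> /(continuous_FT n)[c1 c2]; split; exact: continuous_measurable_fun.
Qed.

(* Folding the line at 0 cancels the cross terms between the real and imaginary parts. *)
Lemma ge0_integralT_fold (G : R -> R) : (forall x : R, 0 <= G x) -> continuous G ->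
  (\int[mu]_x (G x)%:E = \int[mu]_(x in `[(0%R : R), +oo[) (G x + G (- x))%:E)%E.
Proof.
move=> G0 cG.
have mG : measurable_fun setT G by exact: continuous_measurable_fun.
have mN : measurable_fun setT (fun x : R => G (- x)).
  by apply: measurableT_comp => //.
under [RHS]eq_integral do rewrite EFinD.
rewrite ge0_integralD//=; first last.
- by apply/measurable_EFinP; exact: measurable_funTS.
- by move=> x _; rewrite lee_fin.
- by apply/measurable_EFinP; exact: measurable_funTS.
- by move=> x _; rewrite lee_fin.
have mI : measurable (`[(0 : R), +oo[%classic : set (measurableTypeR R)) by exact: measurable_itv.
rewrite -{1}(setUv `[(0 : R), +oo[%classic) ge0_integral_setU//= ; last 4 first.
  exact: measurableC.
  by apply/measurable_EFinP; rewrite setUv.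
  by move=> x _; rewrite lee_fin.
  exact/disj_setPCl.
congr (_ + _)%E.
rewrite setCitvr integral_itv_bndo_bndc; last exact/measurable_EFinP/measurable_funTS.
(* The endpoint 0 is written as -0 to match the reflection x -> -x of the negative half-line. *)
rewrite -{1}oppr0 ge0_integration_by_substitutionNy//.
exact: continuous_subspaceT.
Qed.

End FourierPlancherel.

(** * Plancherel's identity, linearity of the transform, and the multiplier bound *)

Section Regularization.
Context {R : realType}.
Local Notation mu := (@lebesgue_measure R).
Local Notation intg f := (mu.-integrable setT (EFin \o f)).
Local Notation C := (trig_integral cos).
Local Notation S := (trig_integral sin).
Implicit Types (f g h : cfun R) (u : R -> R).

Lemma window_sqrD f n x :
  window (fun x => (f x).1) n x ^+ 2 + window (fun x => (f x).2) n x ^+ 2 =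
  window (fun x => csq (f x)) n x.
Proof. by rewrite /window !patchE; case: ifP => // _; rewrite expr0n addr0. Qed.

(** After folding, the energies of the real and imaginary windows appear with factor 1/pi, which
    cancels the pi in [energyE]. *)
Lemma L2norm2_FT_trunc f n : cL2 f ->
  L2norm2 (FT_trunc f n) = (\int[mu]_x (window (fun x => csq (f x)) n x)%:E)%E.
Proof.
move=> cf; have [m1 m2] := cL2_cmeasurable cf.
set w1 := window (fun x => (f x).1) n; set w2 := window (fun x => (f x).2) n.
have i1 : intg w1 := integrable_window n m1 (cL2_integrable_sqr1 cf).
have i2 : intg w2 := integrable_window n m2 (cL2_integrable_sqr2 cf).
have q1 : intg (fun x => w1 x ^+ 2) := integrable_window_sqr n m1 (cL2_integrable_sqr1 cf).
have q2 : intg (fun x => w2 x ^+ 2) := integrable_window_sqr n m2 (cL2_integrable_sqr2 cf).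
have [c1 c2] := continuous_FT n cf.
rewrite /L2norm2 ge0_integralT_fold; first last.
- move=> x; apply: (continuous_addf (f := fun xi => (FT_trunc f n xi).1 ^+ 2)
    (g := fun xi => (FT_trunc f n xi).2 ^+ 2)).
    by under eq_fun do rewrite expr2; exact: continuous_mulf.
  by under eq_fun do rewrite expr2; exact: continuous_mulf.
- by move=> x; exact: csq_ge0.
pose D (w : R -> R) xi := C w xi ^+ 2 + S w xi ^+ 2.
have pi0 := pi_gt0 R.
(* The normalisation contributes 1/(2 pi), and adding xi and -xi doubles the squares: (a + b)^2 + (a
   - b)^2 = 2 a^2 + 2 b^2. *)
have E1 xi : csq (FT_trunc f n xi) + csq (FT_trunc f n (- xi)) = pi^-1 * (D w1 xi + D w2 xi).
  rewrite !FT_truncE// /csq/= -/w1 -/w2 !trig_integral_cosN !trig_integral_sinN// /D.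
  have k2 : (Num.sqrt (2 * pi))^-1 ^+ 2 = (2 * pi)^-1 :> R.
    by rewrite exprVn sqr_sqrtr// mulr_ge0// ltW.
  rewrite !exprMn k2; move: pi0; move: (@pi R) => q q0; field; by rewrite gt_eqF.
under eq_integral do rewrite E1 EFinM EFinD.
have mD w : intg w -> measurable_fun `[(0 : R), +oo[ (fun xi => (D w xi)%:E).
  by move=> iw; apply/measurable_EFinP; apply: measurable_funTS; exact: measurable_energy_density.
have D0 w xi : (0 <= (D w xi)%:E)%E by rewrite lee_fin energy_density_ge0.
rewrite ge0_integralZl//; first last.
- by rewrite lee_fin invr_ge0 ltW.
- by move=> xi _; rewrite adde_ge0.
- by apply: emeasurable_funD; exact: mD.
rewrite ge0_integralD//; [|exact: mD..].
rewrite -/(energy w1) -/(energy w2).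
rewrite (energyE i1 q1 (@window_out R _ n)) (energyE i2 q2 (@window_out R _ n)).
rewrite -EFinD -EFinM -mulrDr mulrA mulVf ?gt_eqF// mul1r -RintegralD//.
rewrite /Rintegral fineK; first by apply: eq_integral => x _; rewrite window_sqrD.
have := integrableD measurableT q1 q2.
by move=> /integrable_fin_num; apply.
Qed.

Lemma cvg_L2norm2_FT_trunc f : cL2 f -> L2norm2 (FT_trunc f n) @[n --> \oo] --> L2norm2 f.
Proof.
move=> cf; have icf := cL2_integrable_csq cf.
have mf := measurable_csq (cL2_cmeasurable cf).
have := @dominated_convergence _ (measurableTypeR R) R mu setT measurableT
  (fun n x => (window (fun x => csq (f x)) n x)%:E) (fun x => (csq (f x))%:E)
  (EFin \o (fun x => csq (f x))).
case => //.
- by move=> n; apply/measurable_EFinP; exact: measurable_window.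
- by apply/measurable_EFinP.
- apply: aeW => x _; apply: cvg_near_cst; near=> n.
  have xn : `|x| < n%:R by near: n; exact: nbhs_infty_gtr.
  rewrite /window patchE mem_set//= in_itv/=.
  by move: xn; rewrite ltr_norml.
- apply: aeW => x n _; rewrite /= lee_fin /window patchE; case: ifP => _.
    by rewrite ger0_norm// csq_ge0.
  by rewrite normr0 csq_ge0.
move=> _ _; apply: cvg_trans; apply: near_eq_cvg; apply: nearW => n.
by rewrite L2norm2_FT_trunc.
Unshelve. all: by end_near. Qed.

(** The truncated transforms converge to g in L^2 while their squared norms converge to that of f,
    so [L2norm2_limit] equates the two. *)
Lemma is_fourier_norm f g : cL2 f -> is_fourier f g -> L2norm2 g = L2norm2 f.
Proof.
move=> cf [cg fg]; apply: (L2norm2_limit _ _ _ _ (cvg_L2norm2_FT_trunc cf) fg).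
- by move=> n; exact: cmeasurable_FT_trunc.
- exact: cL2_cmeasurable.
- by case: cg => _ [].
- by case: cf => _ [].
Qed.

Lemma cL2B f g : cL2 f -> cL2 g -> cL2 (csub f g).
Proof.
move=> cf cg; have mf := cL2_cmeasurable cf; have mg := cL2_cmeasurable cg.
have mfg := cmeasurableB mf mg; split; [by case: mfg|split; first by case: mfg].
apply: (le_lt_trans (L2norm2_triangle ltr01 mfg mf)).
(* Measured from f, the difference f - g leaves the remainder -g. *)
have -> : L2norm2 (csub (csub f g) f) = L2norm2 g.
  by apply: eq_integral => x _; congr EFin; rewrite /csq/=; ring.
case: cf cg => _ [_ cf] [_ [_ cg]].
by rewrite lte_add_pinfty// lte_mul_pinfty// L2norm2_ge0.
Qed.

Lemma FT_truncB f g n : cL2 f -> cL2 g ->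
  FT_trunc (csub f g) n = csub (FT_trunc f n) (FT_trunc g n).
Proof.
move=> cf cg; apply/funext => xi; have cfg := cL2B cf cg.
have [f1 f2] := cL2_cmeasurable cf; have [g1 g2] := cL2_cmeasurable cg.
have if1 := integrable_window n f1 (cL2_integrable_sqr1 cf).
have if2 := integrable_window n f2 (cL2_integrable_sqr2 cf).
have ig1 := integrable_window n g1 (cL2_integrable_sqr1 cg).
have ig2 := integrable_window n g2 (cL2_integrable_sqr2 cg).
have windowB (u v : R -> R) :
    window (fun x => u x - v x) n = (fun x => window u n x - window v n x).
  by apply/funext => x; rewrite /window !patchE; case: ifP => // _; rewrite subrr.
rewrite /csub !FT_truncE//= !windowB.
rewrite !(trig_integralB xi (@continuous_cos R) (@cos_norm_le1 R))//.
rewrite !(trig_integralB xi (@continuous_sin R) (@sin_norm_le1 R))//.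
by congr (_, _); ring.
Qed.

(** The transform is a relation defined by an L^2 limit, so linearity is proved on the truncations
    and passed to the limit by squeezing. *)
Lemma is_fourierB f1 f2 g1 g2 : cL2 f1 -> cL2 f2 ->
  is_fourier f1 g1 -> is_fourier f2 g2 -> is_fourier (csub f1 f2) (csub g1 g2).
Proof.
move=> cf1 cf2 [cg1 h1] [cg2 h2]; split; first exact: cL2B.
have mF f n : cL2 f -> cmeasurable (FT_trunc f n) by move=> cf; exact: cmeasurable_FT_trunc.
have m1 := cL2_cmeasurable cg1; have m2 := cL2_cmeasurable cg2.
apply: (@squeeze_cvge _ _ _ _ (cst 0%E) _ (fun n => (1 + 1)%:E * L2norm2 (csub (FT_trunc f1 n) g1) +
   (1 + 1^-1)%:E * L2norm2 (csub (FT_trunc f2 n) g2))%E); last 2 first.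
- exact: cvg_cst.
- rewrite [X in _ --> X](_ : _ = (1 + 1)%:E * 0 + (1 + 1^-1)%:E * 0)%E; last by rewrite !mule0 adde0.
  apply: cvgeD; [by rewrite !mule0|exact: cvgeZl|exact: cvgeZl].
apply: nearW => n; rewrite L2norm2_ge0/= FT_truncB//.
have mm1 := cmeasurableB (mF _ n cf1) m1.
have mm := cmeasurableB (cmeasurableB (mF _ n cf1) (mF _ n cf2)) (cmeasurableB m1 m2).
(* With s = 1 and F1 - g1 as main term, the remainder of (F1 - F2) - (g1 - g2) is g2 - F2. *)
apply: (le_trans (L2norm2_triangle ltr01 mm mm1)).
rewrite (L2norm2_csubC (FT_trunc f2 n)) leeD2l// lee_wpmul2l//.
rewrite le_eqVlt; apply/orP; left; apply/eqP; apply: eq_integral => x _.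
by congr EFin; rewrite /csq/=; ring.
Qed.

Lemma powR_le_1D (y a : R) : 0 <= y -> 0 <= a <= 1 -> y `^ a <= 1 + y.
Proof.
move=> y0 /andP[a0 a1]; have [y1|y1] := leP y 1.
  have := @ge0_ler_powR R a a0 y 1; rewrite !nnegrE powR1 => /(_ y0 ler01 y1); lra.
have := ler_powR (ltW y1) a1; rewrite powRr1//; lra.
Qed.

Lemma reg_mult_le (T p beta t xi : R) : 0 < T -> 1 < p -> 0 < beta -> 0 <= t <= T ->
  0 <= reg_mult T p beta t xi <= beta `^ ((t - T) / (p * T)).
Proof.
move=> T0 p1 b0 /andP[t0 tT].
have p0 : 0 < p by exact: lt_trans p1.
have pT : 0 < p * T by rewrite mulr_gt0.
set y := beta * expR (p * T * xi ^+ 2).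
have y0 : 0 < y by rewrite mulr_gt0// expR_gt0.
pose a := (T - t) / (p * T).
(* The upper bound is T - t <= T <= p T, from t >= 0 and p > 1. *)
have a01 : 0 <= a <= 1.
  rewrite divr_ge0 ?subr_ge0 ?(ltW pT)//= ler_pdivrMr// mul1r.
  by rewrite (@le_trans _ _ T)// ?lerBlDr ?lerDl// ler_peMl ?ltW.
have num : expR ((T - t) * xi ^+ 2) = beta `^ ((t - T) / (p * T)) * y `^ a.
  have -> : (t - T) / (p * T) = - a by rewrite /a -mulNr opprB.
  rewrite /y powRM ?expR_ge0 ?(ltW b0)// mulrA -powRD; last by rewrite (gt_eqF b0) implybT.
  rewrite addNr powRr0 mul1r -expRM; congr expR.
  by rewrite /a; field; rewrite !gt_eqF.
rewrite /reg_mult -/y num; have y1 : 0 < 1 + y by rewrite ltr_wpDl.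
rewrite divr_ge0 ?mulr_ge0 ?powR_ge0 ?(ltW y1)//= -mulrA ler_piMr ?powR_ge0//.
by rewrite ler_pdivrMr// mul1r powR_le_1D// ltW.
Qed.

End Regularization.
(** Measurability is asked of the product, which is the form in which [is_fourier] supplies it;
    nonnegativity of m turns m <= B into m^2 <= B^2. *)
Lemma L2norm2_mul_le {R : realType} (m : R -> R) (B : R) (g : cfun R) :
  (forall xi, 0 <= m xi <= B) -> cmeasurable g ->
  cmeasurable (fun xi => (m xi * (g xi).1, m xi * (g xi).2)) ->
  (L2norm2 (fun xi => (m xi * (g xi).1, m xi * (g xi).2)%R)
    <= (B ^+ 2)%:E * L2norm2 g)%E.
Proof.
move=> mB mg mmg.
rewrite /L2norm2 -ge0_integralZl//; first last.
- by rewrite lee_fin sqr_ge0.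
- by move=> x _; rewrite lee_fin csq_ge0.
- by apply/measurable_EFinP; exact: measurable_csq.
apply: ge0_le_integral => //.
- by move=> x _; rewrite lee_fin csq_ge0.
- by apply/measurable_EFinP; exact: (measurable_csq mmg).
- by apply: measurable_funeM; apply/measurable_EFinP; exact: measurable_csq.
move=> x _; have /andP[m0 mxB] := mB x; rewrite -EFinM lee_fin.
have -> : csq (m x * (g x).1, m x * (g x).2) = m x ^+ 2 * csq (g x) by rewrite /csq/=; ring.
by rewrite ler_wpM2r ?csq_ge0// lerXn2r ?nnegrE// (le_trans m0).
Qed.

Theorem theorem1 (R : realType) (T p beta : R) (phi omega : cfun R)
  (w v : R -> R -> R * R) :
  0 < T -> 1 < p -> 0 < beta ->
  cL2 phi -> cL2 omega ->
  is_reg_solution T p beta phi w -> is_reg_solution T p beta omega v ->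
  forall t, 0 <= t <= T ->
    L2norm (csub (fun x => w x t) (fun x => v x t))
      <= powR beta ((t - T) / (p * T)) * L2norm (csub phi omega).
Proof.
move=> T0 p1 b0 cphi comega wsol vsol t tT.
have [cw [g1 [phig1 wg1]]] := wsol t tT; have [cv [g2 [omegag2 vg2]]] := vsol t tT.
have mB xi := reg_mult_le xi T0 p1 b0 tT.
set B := powR beta _ in mB *.
have B0 : 0 <= B by exact: powR_ge0.
have c1 : cL2 g1 by case: phig1.
have c2 : cL2 g2 by case: omegag2.
(* Plancherel is applied twice: to the difference of the data here, and below to the difference of
   the solutions at time t. *)
have Ng := is_fourier_norm (cL2B cphi comega) (is_fourierB cphi comega phig1 omegag2).
have wv := is_fourierB cw cv wg1 vg2.
pose m := reg_mult T p beta t.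
(* Both solutions carry the same multiplier, so it factors out of the difference of their
   transforms. *)
have mE : csub (fun xi => (m xi * (g1 xi).1, m xi * (g1 xi).2))
    (fun xi => (m xi * (g2 xi).1, m xi * (g2 xi).2)) =
    (fun xi => (m xi * (csub g1 g2 xi).1, m xi * (csub g1 g2 xi).2)).
  by apply/funext => xi; rewrite /csub/= !mulrBr.
have Nw := is_fourier_norm (cL2B cw cv) wv.
have cmg := wv.1; rewrite -/m mE in Nw cmg.
have cd := cL2B cphi comega; have dfin : L2norm2 (csub phi omega) \is a fin_num.
  by rewrite ge0_fin_numE ?L2norm2_ge0//; case: cd => _ [].
have := L2norm2_mul_le mB (cL2_cmeasurable (cL2B c1 c2)) (cL2_cmeasurable cmg).
rewrite Nw Ng => le.
(* Writing B as the square root of B^2 puts both sides under one square root; comparing the values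
   of [fine] then requires finiteness. *)
rewrite /L2norm -[B](@ger0_norm _ B)// -sqrtr_sqr -sqrtrM ?sqr_ge0// ler_wsqrtr//.
rewrite -[B ^+ 2]/(fine (B ^+ 2)%:E) -fineM// fine_le// ?fin_numM//.
have cwv := cL2B cw cv.
by rewrite ge0_fin_numE ?L2norm2_ge0//; case: cwv => _ [].
Qed.
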